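(* Let $\nu\in\mathcal P_2(\mathbb R^d)$, $q\in\mathbb N_0$ and $\epsilon>0$ be arbitrary. Let $\eta$ be the law of a $d$-dimensional Gaussian random variable with mean vector $0$ and covariance matrix $\frac{\epsilon^2}{4d}I_d$, and let $\rho=\eta*\nu\in\mathcal P_2(\mathbb R^d)$ be the convolution of $\eta$ and $\nu$. Let $r>0$ be sufficiently large such that $$\rho\big(\bar B(0,r)\big)\ge\Big(1+\frac{\epsilon^2}{16\int_{\mathbb R^d}\|x\|^2\,d\rho(x)}\Big)^{-1},\qquad\int_{\mathbb R^d\setminus\bar B(0,r)}\|x\|^2\,d\rho(x)\le\frac{\epsilon^2}{16}.$$ Then $\rho|_{\bar B(0,r)}\in\mathcal M^q(\mathbb R^d)$ and $\mathcal W_2\big(\rho|_{\bar B(0,r)},\nu\big)\le\epsilon$. (In particular, $\mathcal M^q(\mathbb R^d)$ is dense in $(\mathcal P_2(\mathbb R^d),\mathcal W_2)$.)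
   Context: $\mathbb N_0=\{0,1,2,\dots\}$; $\|\cdot\|$ is the Euclidean norm; $\bar B(0,r)$ is the closed Euclidean ball. $\mathcal P_2(\mathbb R^d)$: Borel probability measures with finite second moment; $\mathcal P_{2,\mathrm{ac}}(\mathbb R^d)$: those absolutely continuous with respect to Lebesgue measure; $\mathcal W_2(\mu,\nu)=(\inf_\pi\int\|x-y\|^2d\pi)^{1/2}$, infimum over couplings. For $\rho(\mathcal X)>0$, $\rho|_{\mathcal X}(A)=\rho(A\cap\mathcal X)/\rho(\mathcal X)$ is the truncation (a probability measure). For a bounded open $U\subset\mathbb R^d$, $q\in\mathbb N_0$, $\alpha\in(0,1]$, $\mathcal C^{q,\alpha}(\mathrm{cl}(U))$ is the set of real continuous functions on $\mathrm{cl}(U)$ that are $q$ times continuously differentiable on $U$ with finite Hölder norm (partial derivatives up to order $q$ bounded and those of order $q$ $\alpha$-Hölder continuous on $U$). $\mathcal S^q(\mathbb R^d)$ is the collection of sets $\mathrm{cl}(\mathcal Y)$ with $\mathcal Y\subset\mathbb R^d$ non-empty, open, bounded, with $\mathcal C^{q+2}$-boundary (locally the graph of a $\mathcal C^{q+2}$ function) and uniformly convex (second fundamental form uniformly positive on the whole boundary). $\mathcal M^q(\mathbb R^d)$ is the set of $\mu\in\mathcal P_{2,\mathrm{ac}}(\mathbb R^d)$ with $\mathrm{supp}(\mu)\in\mathcal S^q(\mathbb R^d)$ that have a density $f_\mu$ such that, for some $\alpha\in(0,1)$ and $\zeta\ge1$, $f_\mu\in\mathcal C^{q,\alpha}(\mathrm{supp}(\mu))$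 and $\zeta^{-1}\le f_\mu(x)\le\zeta$ for all $x\in\mathrm{supp}(\mu)$. *)

(* Defs.v *)
From HB Require Import structures.
From mathcomp Require Import all_boot all_order all_algebra.
From mathcomp Require Import all_classical all_reals all_analysis.
From mathcomp Require Import measurable_realfun lra.

Set Implicit Arguments.
Unset Strict Implicit.
Unset Printing Implicit Defensive.

Import Order.TTheory GRing.Theory Num.Theory.
Import numFieldNormedType.Exports.

Local Open Scope classical_set_scope.
Local Open Scope ring_scope.

(* R^d is 'rV[R]_d. The library norm of 'rV[R]_d is the maximum norm, which
   induces the usual topology; it is used below for topological notions only,
   and metric notions use the Euclidean norm enorm. *)

HB.instance Definition _ (R : realType) (d : nat) :=
  Measurable.copy 'rV[R]_d (g_sigma_algebraType (@open 'rV[R]_d)).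

Section Borel_rV.
Context {R : realType}.

Lemma open_measurable_rV d (U : set 'rV[R]_d) : open U -> measurable U.
Proof. exact: sub_sigma_algebra. Qed.

Lemma closed_measurable_rV d (C : set 'rV[R]_d) : closed C -> measurable C.
Proof.
move=> cC; rewrite -[C]setCK; apply: measurableC.
by apply: open_measurable_rV; exact: closed_openC.
Qed.

Lemma measurable_coord d (i : 'I_d) :
  measurable_fun [set: 'rV[R]_d] (fun v : 'rV[R]_d => v 0 i).
Proof.
apply: (measurability _ (RGenOpens.measurableE R)) => _ [_ [a [b ->]] <-].
rewrite setTI; apply: open_measurable_rV; apply: open_comp.
  by move=> v _; exact: coord_continuous.
exact: interval_open.
Qed.

Lemma measurable_fun_rV disp (T : measurableType disp) d (f : T -> 'rV[R]_d) :
  (forall i, measurable_fun setT (fun t => f t 0 i)) -> measurable_fun setT f.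
Proof.
move=> mf; apply: (measurability (@open 'rV[R]_d)) => [|_ [U oU <-]].
  exact: erefl.
rewrite setTI.
pose box (k : 'rV[rat]_d * nat) : set 'rV[R]_d :=
  \bigcap_(i in [set: 'I_d])
    [set v | v 0 i \in `](ratr (k.1 0 i) - k.2.+1%:R^-1 : R),
                          (ratr (k.1 0 i) + k.2.+1%:R^-1 : R)[].
have -> : U = \bigcup_k (if `[< box k `<=` U >] then box k else set0).
  apply/seteqP; split => [x Ux|x [k _]]; last by case: asboolP => [kU /kU|_ []].
  have /nbhs_ballP[e /= e0 xeU] : nbhs x U by exact: open_nbhs_nbhs.
  have [n] := ltr_add_invr (divr_gt0 e0 (ltr0n R 2) : 0 < e / 2).
  rewrite add0r; set h := _^-1 => he.
  have h0 : 0 < h by rewrite invr_gt0.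
  have qP i : exists q : rat, ratr q \in `](x 0 i - h), (x 0 i + h)[.
    by apply: rat_in_itvoo; rewrite ltrBlDr -addrA ltrDl addr_gt0.
  pose q := \row_i sval (cid (qP i)).
  have qE i : x 0 i - h < ratr (q 0 i) < x 0 i + h.
    by rewrite mxE; case: cid => z /=; rewrite in_itv.
  exists (q, n) => //=; case: asboolP => [_|]; last first.
    case=> y yq; apply: xeU; split => // i j; rewrite (ord1 i).
    have := yq j Logic.I; rewrite /= in_itv/= -/h => /andP[y1 y2].
    have /andP[q1 q2] := qE j.
    rewrite /ball /= ltr_norml; apply/andP.
    by split; move: q1 q2 y1 y2 he; clear; lra.
  move=> i _ /=; rewrite in_itv/= -/h; have /andP[q1 q2] := qE i.
  by apply/andP; split; [rewrite ltrBlDr|rewrite -ltrBlDr].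
rewrite preimage_bigcup; apply: countable_bigcupT_measurable => // k.
case: ifPn => _; last by rewrite preimage_set0.
rewrite preimage_bigcap; apply: fin_bigcap_measurable => // i _.
have := mf i measurableT _ (measurable_itv
  `](ratr (k.1 0 i) - k.2.+1%:R^-1 : R), (ratr (k.1 0 i) + k.2.+1%:R^-1 : R)[).
by rewrite setTI.
Qed.

End Borel_rV.

Section Lebesgue.
Context {R : realType}.

Definition row_cons d (p : measurableTypeR R * 'rV[R]_d) : 'rV[R]_d.+1 :=
  \row_(i < d.+1) oapp (fun j => p.2 0 j) p.1 (unlift ord0 i).

Definition row_uncons d (v : 'rV[R]_d.+1) : measurableTypeR R * 'rV[R]_d :=
  (v 0 ord0, \row_(i < d) v 0 (lift ord0 i)).

Lemma row_consK d : cancel (@row_cons d) (@row_uncons d).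
Proof.
move=> [x v]; rewrite /row_uncons mxE unlift_none /=; congr pair.
by apply/rowP => i; rewrite !mxE liftK.
Qed.

Lemma row_unconsK d : cancel (@row_uncons d) (@row_cons d).
Proof.
move=> v; apply/rowP => i; rewrite mxE.
by case: unliftP => [j ->|->] //=; rewrite mxE.
Qed.

Lemma measurable_row_cons d : measurable_fun setT (@row_cons d).
Proof.
apply: measurable_fun_rV => i.
under eq_fun do rewrite mxE.
case: (unlift ord0 i) => [j|] /=; last exact: measurable_fst.
exact: (measurableT_comp (measurable_coord j) measurable_snd).
Qed.

HB.instance Definition _ d :=
  isMeasurableFun.Build _ _ _ _ (@row_cons d) (@measurable_row_cons d).

Lemma measurable_row_uncons d : measurable_fun setT (@row_uncons d).
Proof.
apply/measurable_fun_pairP; split; first exact: measurable_coord.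
apply: measurable_fun_rV => i /=.
under eq_fun do rewrite mxE.
exact: measurable_coord.
Qed.

Definition lebesgue_cons d (m : {sigma_finite_measure set 'rV[R]_d -> \bar R}) :
    set 'rV[R]_d.+1 -> \bar R :=
  pushforward (@lebesgue_measure R \x m)%E (@row_cons d).

Section lebesgue_cons_instances.
Variables (d : nat) (m : {sigma_finite_measure set 'rV[R]_d -> \bar R}).

Let lebesgue_cons0 : lebesgue_cons m set0 = 0%E.
Proof. by rewrite /lebesgue_cons /pushforward preimage_set0 measure0. Qed.

Let lebesgue_cons_ge0 A : (0 <= lebesgue_cons m A)%E.
Proof. by rewrite /lebesgue_cons /pushforward; exact: measure_ge0. Qed.

Let measurable_preimage A :
  measurable A -> measurable (@row_cons d @^-1` A).
Proof.
by move=> mA; rewrite -[X in measurable X]setTI; exact: measurable_row_cons.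
Qed.

Let lebesgue_cons_sigma_additive : semi_sigma_additive (lebesgue_cons m).
Proof.
move=> F mF tF mUF; rewrite /lebesgue_cons /pushforward preimage_bigcup.
apply: measure_semi_sigma_additive.
- by move=> n; exact: measurable_preimage.
- apply/trivIsetP => i j _ _ ij; rewrite -preimage_setI.
  by move/trivIsetP : tF => /(_ _ _ Logic.I Logic.I ij) ->; rewrite preimage_set0.
- by rewrite -preimage_bigcup; exact: measurable_preimage.
Qed.

HB.instance Definition _ := isMeasure.Build _ _ _ (lebesgue_cons m)
  lebesgue_cons0 lebesgue_cons_ge0 lebesgue_cons_sigma_additive.

Lemma lebesgue_cons_sigma_finite : sigma_finite setT (lebesgue_cons m).
Proof.
have /sigma_finiteP[F [TF ndF Foo]] := sigma_finiteT (@lebesgue_measure R).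
have /sigma_finiteP[G [TG ndG Goo]] := sigma_finiteT m.
exists (fun n => @row_uncons d @^-1` (F n `*` G n)).
  rewrite -preimage_bigcup; apply/esym/seteqP; split => // v _ /=.
  have [n _ Fn] : (\bigcup_n F n) (row_uncons v).1 by rewrite -TF.
  have [k _ Gk] : (\bigcup_n G n) (row_uncons v).2 by rewrite -TG.
  exists (maxn n k) => //; split.
  - by move: Fn; exact/subsetPset/ndF/leq_maxl.
  - by move: Gk; exact/subsetPset/ndG/leq_maxr.
move=> n; have [? ?] := Foo n; have [? ?] := Goo n; split.
  rewrite -[X in measurable X]setTI.
  by apply: measurable_row_uncons => //; exact: measurableX.
rewrite /lebesgue_cons /pushforward -comp_preimage.
have -> : @row_uncons d \o @row_cons d = idfun.
  by apply/funext => p /=; rewrite row_consK.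
by rewrite preimage_id product_measure1E// lte_mul_pinfty// ge0_fin_numE.
Qed.

HB.instance Definition _ :=
  Measure_isSigmaFinite.Build _ _ _ (lebesgue_cons m) lebesgue_cons_sigma_finite.

End lebesgue_cons_instances.

(* Lebesgue measure on R^d: lebesgue_rV d.+1 is the image of the product of
   the Lebesgue measures of R and R^d under (x, v) |-> (x, v_0, ..., v_(d-1)). *)
Fixpoint lebesgue_rV d : {sigma_finite_measure set 'rV[R]_d -> \bar R} :=
  match d with
  | 0 => @dirac _ 'rV[R]_0 0 R
  | d'.+1 => lebesgue_cons (lebesgue_rV d')
  end.

End Lebesgue.
Arguments lebesgue_rV {R} d.

Section Euclidean.
Context {R : realType}.

Definition enorm d (x : 'rV[R]_d) : R := Num.sqrt (\sum_(i < d) x 0 i ^+ 2).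

Definition eball d (r : R) : set 'rV[R]_d := [set x | enorm x <= r].

Lemma measurable_enorm d : measurable_fun setT (@enorm d).
Proof.
apply: (@measurableT_comp _ _ _ _ _ _ (@Num.sqrt R)).
  by apply: continuous_measurable_fun; exact: sqrt_continuous.
apply: measurable_sum => i.
by apply: measurable_funX; exact: measurable_coord.
Qed.

Lemma measurable_eball d r : measurable (@eball d r).
Proof.
have := @measurable_enorm d measurableT _ (measurable_itv `]-oo, r]).
by rewrite setTI; congr measurable.
Qed.

End Euclidean.
Arguments eball {R} d r.
Arguments measurable_eball {R} d r.

Section measures.
Context {R : realType}.

Definition second_moment d (mu : probability 'rV[R]_d R) : \bar R :=
  (\int[mu]_x (enorm x ^+ 2)%:E)%E.

Definition P2 d (mu : probability 'rV[R]_d R) : Prop :=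
  (second_moment mu < +oo)%E.

Definition P2ac d (mu : probability 'rV[R]_d R) : Prop :=
  P2 mu /\ mu `<< lebesgue_rV d.

Definition coupling d (mu nu : probability 'rV[R]_d R)
    (pi : probability ('rV[R]_d * 'rV[R]_d)%type R) : Prop :=
  forall A : set 'rV[R]_d, measurable A ->
    pi (A `*` setT) = mu A /\ pi (setT `*` A) = nu A.

Definition W2 d (mu nu : probability 'rV[R]_d R) : \bar R :=
  sqrte (ereal_inf
    [set (\int[pi]_z (enorm (z.1 - z.2) ^+ 2)%:E)%E | pi in coupling mu nu]).

Definition vadd d (p : 'rV[R]_d * 'rV[R]_d) : 'rV[R]_d := p.1 + p.2.

Lemma measurable_vadd d : measurable_fun setT (@vadd d).
Proof.
apply: measurable_fun_rV => i; under eq_fun do rewrite mxE.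
apply: measurable_funD.
- exact: (measurableT_comp (measurable_coord i) measurable_fst).
- exact: (measurableT_comp (measurable_coord i) measurable_snd).
Qed.

HB.instance Definition _ d :=
  isMeasurableFun.Build _ _ _ _ (@vadd d) (@measurable_vadd d).

Definition convolution d (mu nu : probability 'rV[R]_d R) :
    probability 'rV[R]_d R :=
  distribution (mu \x nu)%E (@vadd d).

(* rho(. `&` D) / rho(D); the value is rho itself when rho(D) = 0. *)
Definition truncation d (rho : probability 'rV[R]_d R) (D : set 'rV[R]_d)
    (mD : measurable D) : probability 'rV[R]_d R :=
  mnormalize (mrestr rho mD) rho.

(* Density of the Gaussian law with mean m and symmetric positive definite
   covariance matrix S. *)
Definition gaussian_pdf d (m : 'rV[R]_d) (S : 'M[R]_d) (x : 'rV[R]_d) : R :=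
  (Num.sqrt ((2 * pi) ^+ d * \det S))^-1 *
  expR (- ((x - m) *m invmx S *m (x - m)^T) 0 0 / 2).

Definition has_density d (mu : probability 'rV[R]_d R) (f : 'rV[R]_d -> R) :
    Prop :=
  [/\ measurable_fun setT f, forall x, 0 <= f x &
      forall A : set 'rV[R]_d, measurable A ->
        mu A = (\int[lebesgue_rV d]_(x in A) (f x)%:E)%E].

Definition gaussian_law d (m : 'rV[R]_d) (S : 'M[R]_d)
    (mu : probability 'rV[R]_d R) : Prop :=
  has_density mu (gaussian_pdf m S).

Definition supp d (mu : probability 'rV[R]_d R) : set 'rV[R]_d :=
  [set x | forall U : set 'rV[R]_d, open U -> U x -> (0 < mu U)%E].

End measures.

Section regularity.
Context {R : realType}.

Definition basis_vec d (i : 'I_d) : 'rV[R]_d := delta_mx 0 i.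

(* Iterated partial derivatives; the multi-index is the list of the directions
   of differentiation. *)
Fixpoint partials d (s : seq 'I_d) (f : 'rV[R]_d -> R) : 'rV[R]_d -> R :=
  if s is i :: s' then 'D_(basis_vec i) (partials s' f) else f.

(* f is k times continuously differentiable on the open set U. *)
Definition Ck_on d (k : nat) (U : set 'rV[R]_d) (f : 'rV[R]_d -> R) : Prop :=
  (forall s : seq 'I_d, (size s <= k)%N ->
     forall x, U x -> {for x, continuous (partials s f)}) /\
  (forall s : seq 'I_d, (size s < k)%N ->
     forall i x, U x -> derivable (partials s f) x (basis_vec i)).

(* f restricted to closure U belongs to C^{q,alpha}(closure U). *)
Definition holder d (q : nat) (alpha : R) (U : set 'rV[R]_d)
    (f : 'rV[R]_d -> R) : Prop :=
  [/\ {within closure U, continuous f},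
      Ck_on q U f,
      forall s : seq 'I_d, (size s <= q)%N ->
        exists M : R, forall x, U x -> `|partials s f x| <= M &
      forall s : seq 'I_d, size s = q ->
        exists C : R, forall x y, U x -> U y ->
          `|partials s f x - partials s f y| <= C * enorm (x - y) `^ alpha].

Definition bdry d (Y : set 'rV[R]_d) : set 'rV[R]_d :=
  closure Y `&` closure (~` Y).

(* In the orthonormal coordinates x *m O, the j-th one is the height and the
   other ones parametrise the horizontal hyperplane. *)
Definition height d (O : 'M[R]_d) (j : 'I_d) (x : 'rV[R]_d) : R :=
  (x *m O) 0 j.

Definition horizontal d (O : 'M[R]_d) (j : 'I_d) (x : 'rV[R]_d) :
    'rV[R]_d.-1 :=
  col' j (x *m O).

(* Near p, Y is the region above the graph of the C^k function g. *)
Definition graph_chart d (k : nat) (Y : set 'rV[R]_d) (p : 'rV[R]_d)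
    (O : 'M[R]_d) (j : 'I_d) (g : 'rV[R]_d.-1 -> R) : Prop :=
  O *m O^T = 1%:M /\
  exists (V : set 'rV[R]_d.-1) (N : set 'rV[R]_d),
    [/\ open V, open N, N p, Ck_on k V g &
        forall x, N x -> V (horizontal O j x) /\
                         (Y x <-> g (horizontal O j x) < height O j x)].

Definition Ck_boundary d (k : nat) (Y : set 'rV[R]_d) : Prop :=
  forall p, bdry Y p -> exists O j g, graph_chart k Y p O j g.

(* First fundamental form of the graph of g at (u, g u), evaluated at the
   tangent vector (w, 'D_w g u). *)
Definition first_form n (g : 'rV[R]_n -> R) (u w : 'rV[R]_n) : R :=
  enorm w ^+ 2 + ('D_w g u) ^+ 2.

(* Second fundamental form of the graph of g at the same tangent vector, with
   respect to the upward unit normal (- grad g, 1) / sqrt (1 + |grad g|^2),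
   which points into the region above the graph. *)
Definition second_form n (g : 'rV[R]_n -> R) (u w : 'rV[R]_n) : R :=
  'D_w ('D_w g) u /
  Num.sqrt (1 + \sum_(i < n) ('D_(basis_vec i) g u) ^+ 2).

(* The fundamental forms do not depend on the chart, so that one chart at each
   boundary point is enough. Convexity is not a consequence of the second
   condition: two disjoint balls satisfy it. *)
Definition uniformly_convex d (Y : set 'rV[R]_d) : Prop :=
  convex_set Y /\
  exists2 c : R, 0 < c & forall p, bdry Y p ->
    exists O j g, graph_chart 2 Y p O j g /\
      forall w, c * first_form g (horizontal O j p) w <=
                second_form g (horizontal O j p) w.

(* S^q(R^d) is the collection of the closures of these sets. *)
Definition Sq_domain d (q : nat) (Y : set 'rV[R]_d) : Prop :=
  [/\ Y !=set0, open Y, bounded_set Y, Ck_boundary q.+2 Y &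
      uniformly_convex Y].

Definition Mq d (q : nat) (mu : probability 'rV[R]_d R) : Prop :=
  P2ac mu /\
  exists Y : set 'rV[R]_d,
    [/\ Sq_domain q Y, supp mu = closure Y &
        exists f : 'rV[R]_d -> R, has_density mu f /\
        exists alpha zeta : R,
          [/\ 0 < alpha < 1, 1 <= zeta, holder q alpha Y f &
              forall x, supp mu x -> zeta^-1 <= f x <= zeta]].

End regularity.

(* Main.v *)
Require Import Defs.
From HB Require Import structures.
From mathcomp Require Import all_boot all_order all_algebra.
From mathcomp Require Import all_classical all_reals all_analysis.
From mathcomp Require Import measurable_realfun interval_inference ring lra.

Set Implicit Arguments.
Unset Strict Implicit.
Unset Printing Implicit Defensive.

Import Order.TTheory GRing.Theory Num.Theory.
Import numFieldNormedType.Exports.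

Local Open Scope classical_set_scope.
Local Open Scope ring_scope.

(** The bound on the Wasserstein distance needs no triangle inequality: one
    explicit coupling suffices. Let [Z] have law [eta], let [X] have law [nu],
    and let [Y'] have the truncated law, all independent, so that [Z + X] has
    law [rho]. Let [Y] be [Z + X] when this point lies in the ball [D], and [Y']
    otherwise. Then [Y] has the truncated law, because
    [rho (A `&` D) + rho (~` D) * rho (A `&` D) / rho D = rho (A `&` D) / rho D]
    ([resample_couplingP]). Write [Y - X = Z + (Y - (Z + X))]. By the inequality
    [|a + b|^2 <= 2 |a|^2 + 2 |b|^2] the cost is at most twice the second moment
    of [eta], which is at most [eps^2 / 4] ([gaussian_second_moment_le]), plus
    four times the sum of the second moment of [rho] outside [D] and of
    [rho (~` D)] times the second moment of the truncated law
    ([resample_coupling_cost_le]). The two hypotheses on the radius bound each of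
    the last two quantities by [eps^2 / 16], and the total is [eps^2]
    ([W2_truncation_le]).

    For the regularity of the truncated law, Lebesgue measure is invariant under
    translations ([ge0_integral_shift]), so that Tonelli's theorem gives [rho]
    the density [mollify nu g], the average over [y] of the translates
    [g (x - y)] of the Gaussian density [g] ([has_density_convolution]).
    Polynomials times a Gaussian function form a class that is closed under
    partial derivatives and whose members are bounded, hence Lipschitz; a Taylor
    bound that is uniform in the base point then passes to the averages. So the
    mollification of every such function is smooth, with bounded and Lipschitz
    derivatives of all orders, hence Hoelder on a bounded set
    ([mollify_is_derive], [holder_mollify]). The density is positive and
    continuous, therefore bounded below on the compact ball; since Lebesgue
    measure charges nonempty open sets, the support is exactly the closed ball
    ([Mq_truncation]).

    The open ball is an admissible domain ([Sq_domain_oball]): near a boundary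
    point some coordinate does not vanish, so that, after a change of sign, the
    sphere is there a piece of the lower hemisphere
    [u |-> - sqrt (r^2 - |u|^2)]. All derivatives of this function belong to the
    algebra generated by the coordinates, the square root and its inverse, and
    its second fundamental form is [1 / r] times the first one.

    Density follows because Gaussian laws with the required covariance exist
    ([gaussian_law_exists]) and large balls carry almost all of the mass and of
    the second moment ([exists_radius]). *)

(** * Lebesgue measure on R^d *)

Section lebesgue_rV_theory.
Context {R : realType}.

Lemma lebesgue_rVS d (A : set 'rV[R]_d.+1) :
  lebesgue_rV d.+1 A =
  (@lebesgue_measure R \x lebesgue_rV d)%E (@row_cons R d @^-1` A).
Proof. by []. Qed.

Lemma ge0_integral_lebesgue_rVS d (f : 'rV[R]_d.+1 -> \bar R) :
    measurable_fun setT f -> (forall x, 0 <= f x)%E ->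
  (\int[lebesgue_rV d.+1]_x f x =
   \int[@lebesgue_measure R]_t \int[lebesgue_rV d]_v f (row_cons (t, v)))%E.
Proof.
move=> mf f0.
rewrite (eq_measure_integral (pushforward
  (@lebesgue_measure R \x lebesgue_rV d)%E (@row_cons R d))); last first.
  by [].
rewrite (ge0_integral_pushforward (@measurable_row_cons R d))//.
rewrite preimage_setT fubini_tonelli1//.
  by apply: measurableT_comp => //; exact: measurable_row_cons.
by move=> x; exact: f0.
Qed.

Lemma lebesgue_measure_shift (a : R) (A : set R) : measurable A ->
  lebesgue_measure ((fun x => x + a) @^-1` A) = lebesgue_measure A.
Proof.
move=> mA.
have mS : measurable_fun setT (fun x : measurableTypeR R => x + a : measurableTypeR R).
  exact: measurable_funD.
pose S : {mfun measurableTypeR R >-> measurableTypeR R} :=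
  HB.pack (fun x : measurableTypeR R => x + a : measurableTypeR R)
    (isMeasurableFun.Build _ _ _ _ _ mS).
have -> // : lebesgue_measure A = pushforward (@lebesgue_measure R) S A.
apply: (@lebesgue_measure_unique R (pushforward (@lebesgue_measure R) S)) => //.
move=> _ [[x y] _ <-].
transitivity (lebesgue_measure `]x - a, y - a]%classic).
  rewrite !lebesgue_measure_itv /= !lte_fin ltrD2r.
  by case: ifP => // _; rewrite -!EFinD; congr _%:E; ring.
congr (lebesgue_measure _); apply/seteqP; split => z.
  by rewrite /= !in_itv /= ltrBlDr lerBrDr.
by rewrite /= !in_itv /= ltrBlDr lerBrDr.
Qed.

Lemma measurable_shift_rV d (w : 'rV[R]_d) :
  measurable_fun setT (fun v : 'rV[R]_d => v + w).
Proof.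
apply: measurable_fun_rV => i; under eq_fun do rewrite mxE.
by apply: measurable_funD => //; exact: measurable_coord.
Qed.

Lemma ge0_integral_shift1 (a : R) (f : R -> \bar R) :
    measurable_fun setT f -> (forall x, 0 <= f x)%E ->
  (\int[@lebesgue_measure R]_x f (x + a)%R = \int[@lebesgue_measure R]_x f x)%E.
Proof.
move=> mf f0.
have mS : measurable_fun setT (fun x : measurableTypeR R => x + a : measurableTypeR R).
  exact: measurable_funD.
pose S : {mfun measurableTypeR R >-> measurableTypeR R} :=
  HB.pack (fun x : measurableTypeR R => x + a : measurableTypeR R)
    (isMeasurableFun.Build _ _ _ _ _ mS).
rewrite [RHS](eq_measure_integral (pushforward (@lebesgue_measure R) S)).
  by rewrite (ge0_integral_pushforward mS).
by move=> A mA _; exact/esym/(lebesgue_measure_shift a mA).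
Qed.

(** Translation invariance, by induction on the dimension: [row_cons] maps a
    translation of the product to a translation of R^d. *)
Lemma ge0_integral_shift d (w : 'rV[R]_d) (f : 'rV[R]_d -> \bar R) :
    measurable_fun setT f -> (forall x, 0 <= f x)%E ->
  (\int[lebesgue_rV d]_x f (x + w)%R = \int[lebesgue_rV d]_x f x)%E.
Proof.
elim: d w f => [|d IH] w f mf f0.
  by apply: eq_integral => x _; congr f; apply/rowP => -[].
rewrite !ge0_integral_lebesgue_rVS//; last first.
  by apply: measurableT_comp => //; exact: measurable_shift_rV.
pose F t := (\int[lebesgue_rV d]_v f (row_cons (t, v)))%E.
have mfc : measurable_fun setT (fun z : measurableTypeR R * 'rV[R]_d => f (row_cons z)).
  by apply: measurableT_comp => //; exact: measurable_row_cons.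
rewrite -[RHS](@ge0_integral_shift1 (w 0 ord0)); first last.
- by move=> x; exact: integral_ge0.
- exact: (@measurable_fun_fubini_tonelli_F _ _ _ _ _ _ _ mfc).
apply: eq_integral => t _.
rewrite -[RHS](IH (\row_(i < d) w 0 (lift ord0 i))) //; last first.
  exact: (measurable_fun_pair2 (t + w 0 ord0) mfc).
apply: eq_integral => v _; congr f; apply/rowP => i; rewrite !mxE.
by case: unliftP => [j ->|->] /=; rewrite ?mxE ?liftK.
Qed.

Lemma lebesgue_rV_ball_gt0 d (x : 'rV[R]_d) (e : R) : 0 < e ->
  (0 < lebesgue_rV d (ball x e))%E.
Proof.
move=> e0; elim: d x => [|d IH] x.
  rewrite /= /dirac indicE mem_set ?lte01//.
  by split => // i [].
have mb n (y : 'rV[R]_n) : measurable (ball y e).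
  by apply: open_measurable_rV; exact: ball_open.
set y := \row_(i < d) x 0 (lift ord0 i).
apply: (@lt_le_trans _ _
  ((@lebesgue_measure R \x lebesgue_rV d)%E (ball (x 0 ord0) e `*` ball y e))).
  rewrite product_measure1E//; last by apply: measurable_ball.
  rewrite mule_gt0 ?IH// [ltRHS](_ : _ = (e *+ 2)%:E) ?lte_fin ?mulrn_wgt0//.
  exact: (lebesgue_measure_ball _ (ltW e0)).
rewrite lebesgue_rVS; apply: le_measure; rewrite ?inE.
- by apply: measurableX => //; exact: measurable_ball.
- rewrite -[X in measurable X]setTI.
  exact: measurable_row_cons.
- move=> [t v] [/= xt [_ yv]]; split=> // i j; rewrite !mxE ord1.
  case: unliftP => [k ->|->] //=.
  by have := yv ord0 k; rewrite mxE.
Qed.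

Lemma lebesgue_rV_open_gt0 d (U : set 'rV[R]_d) : open U -> U !=set0 ->
  (0 < lebesgue_rV d U)%E.
Proof.
move=> oU [x Ux].
have /nbhs_ballP[e /= e0 xeU] : nbhs x U by exact: open_nbhs_nbhs.
apply: (lt_le_trans (lebesgue_rV_ball_gt0 x e0)).
apply: le_measure => //; rewrite inE; apply: open_measurable_rV => //.
exact: ball_open.
Qed.

End lebesgue_rV_theory.

(** * Densities and convolution *)

Section densities.
Context {R : realType} {d : nat}.
Implicit Types (mu nu : probability 'rV[R]_d R) (f g : 'rV[R]_d -> R).

Lemma has_density_dominates mu f : has_density mu f -> mu `<< lebesgue_rV d.
Proof.
move=> [mf f0 muE]; apply/null_content_dominatesP => A mA A0; rewrite muE//.
apply: null_set_integral => //; apply: measurable_funTS.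
exact/measurable_EFinP.
Qed.

(** By uniqueness up to null sets, [f] may replace the Radon-Nikodym derivative
    of [mu] in the change of variables formula. *)
Lemma ge0_integral_density mu f (h : 'rV[R]_d -> \bar R) :
    has_density mu f -> measurable_fun setT h -> (forall x, 0 <= h x)%E ->
  (\int[mu]_x h x = \int[lebesgue_rV d]_x (h x * (f x)%:E))%E.
Proof.
move=> Hd mh h0; have numu := has_density_dominates Hd.
have [mf f0 muE] := Hd.
have mEf : measurable_fun setT (EFin \o f) by exact/measurable_EFinP.
rewrite -(Radon_Nikodym_SigmaFinite.change_of_variables numu h0 measurableT mh).
apply: ae_eq_integral => //.
- apply: emeasurable_funM => //.
  exact: (measurable_int _ (Radon_Nikodym_SigmaFinite.f_integrable numu)).
- exact: emeasurable_funM.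
- apply: ae_eqe_mul2l; apply: integral_ae_eq => //.
    exact: Radon_Nikodym_SigmaFinite.f_integrable.
  by move=> E _ mE; rewrite -Radon_Nikodym_SigmaFinite.f_integral// -muE.
Qed.

(** The convolution of the function [g] with the measure [nu]. The integral is
    real-valued; it is meaningful for bounded measurable [g]. *)
Definition mollify nu g (x : 'rV[R]_d) : R := Rintegral nu setT (fun y => g (x - y)).

Lemma measurable_sub_rV (x : 'rV[R]_d) :
  measurable_fun setT (fun y : 'rV[R]_d => x - y).
Proof.
apply: measurable_fun_rV => i; under eq_fun do rewrite !mxE.
by apply: measurable_funB => //; exact: measurable_coord.
Qed.

Lemma measurable_sub2_rV :
  measurable_fun setT (fun z : 'rV[R]_d * 'rV[R]_d => z.1 - z.2).
Proof.
apply: measurable_fun_rV => i; under eq_fun do rewrite !mxE.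
apply: measurable_funB.
- exact: (measurableT_comp (measurable_coord i) measurable_fst).
- exact: (measurableT_comp (measurable_coord i) measurable_snd).
Qed.

Lemma integrable_bounded nu g (M : R) : measurable_fun setT g ->
  (forall x, `|g x| <= M) -> nu.-integrable setT (EFin \o g).
Proof.
move=> mg gM; apply: (@le_integrable _ _ _ _ _ measurableT _ (cst M%:E)) => //.
- exact/measurable_EFinP.
- by move=> x _ /=; rewrite lee_fin (le_trans (gM x))// ler_norm.
- by apply: finite_measure_integrable_cst.
Qed.

Lemma integrable_mollify nu g (M : R) x : measurable_fun setT g ->
  (forall x, `|g x| <= M) -> nu.-integrable setT (fun y => (g (x - y))%:E).
Proof.
move=> mg gM; apply: (@integrable_bounded nu (fun y => g (x - y)) M) => //.
exact: (measurableT_comp mg (measurable_sub_rV x)).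
Qed.

Lemma mollifyE nu g (M : R) x : measurable_fun setT g ->
  (forall x, `|g x| <= M) -> (mollify nu g x)%:E = (\int[nu]_y (g (x - y))%:E)%E.
Proof.
move=> mg gM; rewrite /mollify /Rintegral fineK//.
exact: integrable_fin_num (integrable_mollify nu x mg gM).
Qed.

Lemma measurable_mollify nu g (M : R) : measurable_fun setT g ->
  (forall x, 0 <= g x <= M) -> measurable_fun setT (mollify nu g).
Proof.
move=> mg gM; apply/measurable_EFinP.
have -> : EFin \o mollify nu g = fubini_F nu
    (fun z : 'rV[R]_d * 'rV[R]_d => (g (z.1 - z.2))%:E).
  apply/funext => x; rewrite /= (@mollifyE _ _ M)// => y.
  by have /andP[? ?] := gM y; rewrite ger0_norm.
apply: measurable_fun_fubini_tonelli_F.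
  by apply/measurable_EFinP; exact: (measurableT_comp mg measurable_sub2_rV).
by move=> z; rewrite lee_fin; have /andP[] := gM (z.1 - z.2).
Qed.

Lemma has_density_convolution mu nu g (M : R) : (forall x, g x <= M) ->
  has_density mu g -> has_density (convolution mu nu) (mollify nu g).
Proof.
move=> gM [mg g0 muE].
have gM' x : `|g x| <= M by rewrite ger0_norm.
have mgz : measurable_fun setT (fun z : 'rV[R]_d * 'rV[R]_d => (g (z.1 - z.2))%:E).
  by apply/measurable_EFinP; exact: (measurableT_comp mg measurable_sub2_rV).
split.
- by apply: (@measurable_mollify _ _ M) => // x; rewrite g0 gM.
- move=> x; rewrite -lee_fin (mollifyE _ _ mg gM') integral_ge0// => y _.
  by rewrite lee_fin.
move=> A mA.
have mvA : measurable (@vadd R d @^-1` A).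
  by rewrite -[X in measurable X]setTI; exact: measurable_vadd.
rewrite integral_mkcond.
pose F (z : 'rV[R]_d * 'rV[R]_d) : \bar R := (\1_A z.1 * g (z.1 - z.2))%:E.
have mF : measurable_fun setT F.
  apply/measurable_EFinP; apply: measurable_funM; last exact/measurable_EFinP.
  by apply: measurableT_comp => //; exact: measurable_fst.
have F0 z : (0 <= F z)%E by rewrite lee_fin mulr_ge0.
transitivity (\int[lebesgue_rV d]_x \int[nu]_y F (x, y))%E; last first.
  apply: eq_integral => x _; rewrite patchE /F /=.
  under eq_integral do rewrite EFinM.
  rewrite ge0_integralZl//.
  - rewrite (@mollifyE _ _ M)// indicE; case: ifP => _; first by rewrite mul1e.
    by rewrite mul0e.
  - exact: (measurable_fun_pair2 x mgz).
  - by move=> y _; rewrite lee_fin.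
rewrite (fubini_tonelli _ mF F0).
transitivity (\int[nu]_y mu (ysection (@vadd R d @^-1` A) y))%E.
  transitivity ((mu \x nu)%E (@vadd R d @^-1` A)) => //.
  transitivity ((mu \x^ nu)%E (@vadd R d @^-1` A)) => //.
  apply: product_measure_unique => // B C mB mC.
  exact: product_measure2E.
apply: eq_integral => y _.
rewrite muE; last exact: measurable_ysection.
rewrite integral_mkcond -[RHS](ge0_integral_shift y); first last.
- by move=> x; exact: F0.
- exact: (measurable_fun_pair1 y mF).
apply: eq_integral => x _; rewrite patchE /F /= addrK indicE.
rewrite [x \in _](_ : _ = (x + y \in A)); last first.
  by rewrite /ysection/=; apply/idP/idP; rewrite !inE/= ?inE.
by case: ifP => _; rewrite ?mul1r ?mul0r.
Qed.

End densities.

(** * Euclidean norm *)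

Section enorm_theory.
Context {R : realType}.

Lemma enorm_sqr d (x : 'rV[R]_d) : enorm x ^+ 2 = \sum_(i < d) x 0 i ^+ 2.
Proof. by rewrite sqr_sqrtr// sumr_ge0// => i _; exact: sqr_ge0. Qed.

Lemma enorm_ge0 d (x : 'rV[R]_d) : 0 <= enorm x.
Proof. exact: sqrtr_ge0. Qed.

Lemma enorm_sqr_row_cons d (t : R) (v : 'rV[R]_d) :
  enorm (row_cons (t, v)) ^+ 2 = t ^+ 2 + enorm v ^+ 2.
Proof.
rewrite !enorm_sqr big_ord_recl mxE unlift_none; congr (_ + _).
by apply: eq_bigr => i _; rewrite mxE liftK.
Qed.

Lemma enorm_sqrD_le d (x y : 'rV[R]_d) :
  enorm (x + y) ^+ 2 <= 2 * enorm x ^+ 2 + 2 * enorm y ^+ 2.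
Proof.
rewrite !enorm_sqr !mulr_sumr -big_split /=; apply: ler_sum => i _; rewrite mxE.
have := sqr_ge0 (x 0 i - y 0 i); nra.
Qed.

Lemma measurable_enorm_sqr d : measurable_fun setT (fun x : 'rV[R]_d => enorm x ^+ 2).
Proof. by apply: measurable_funX; exact: measurable_enorm. Qed.

End enorm_theory.

(** * Isotropic Gaussian laws *)

Section gaussian.
Context {R : realType}.

(** Only the upper bound on the variance is needed. From
    [u exp (- u) <= 1 - exp (- u)], the second moment for the deviation [s] is
    controlled by the difference of the normalising constants for [s] and for a
    slightly larger deviation [s']; then [s'] tends to [s]. *)
Lemma normal_second_moment_le (s : R) : 0 < s ->
  (\int[@lebesgue_measure R]_t (t ^+ 2 * normal_pdf 0 s t)%:E <= (s ^+ 2)%:E)%E.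
Proof.
move=> s0; apply/lee_addgt0Pr => e e0; rewrite -EFinD.
set M := (X in (X <= _)%E).
have M0 : (0 <= M)%E.
  by apply: integral_ge0 => t _; rewrite lee_fin mulr_ge0 ?sqr_ge0 ?normal_pdf_ge0.
pose s' := Num.sqrt (s ^+ 2 + e).
have s2 : 0 < s ^+ 2 by rewrite exprn_gt0.
have s'2 : s' ^+ 2 = s ^+ 2 + e by rewrite sqr_sqrtr// addr_ge0 ?ltW.
have s'0 : 0 < s' by rewrite sqrtr_gt0 addr_gt0.
have ss' : s < s' by rewrite -(ltr_pXn2r (n:=2)) ?nnegrE ?ltW// s'2 ltrDl.
pose k := (s ^+ 2 *+ 2)^-1 - (s' ^+ 2 *+ 2)^-1.
have k0 : 0 < k.
  rewrite subr_gt0 ltf_pV2 ?posrE ?mulrn_wgt0 ?exprn_gt0// s'2.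
  by rewrite ltr_pMn2r ?ltrDl.
(* [u exp (- u) <= 1 - exp (- u)] for [u = k t^2], times [s' / s] times the
   density for [s'] *)
have key t : k * (t ^+ 2 * normal_pdf 0 s t) + normal_pdf 0 s t <=
    s' / s * normal_pdf 0 s' t.
  rewrite !normal_pdfE ?gt_eqF// /normal_fun !subr0.
  have -> : normal_peak s' = s / s' * normal_peak s.
    rewrite /normal_peak -!mulrnAr (sqrtrM _ (sqr_ge0 s)).
    rewrite (sqrtrM _ (sqr_ge0 s')) !sqrtr_sqr !gtr0_norm//.
    have : Num.sqrt (pi *+ 2 : R) != 0.
      by rewrite gt_eqF// sqrtr_gt0 mulrn_wgt0 ?pi_gt0.
    by move=> q0; field; rewrite q0 !gt_eqF.
  have := @normal_peak_gt0 R s; rewrite gt_eqF// => /(_ isT) p0.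
  set p := normal_peak s in p0 *.
  rewrite !mulrA mulfVK ?gt_eqF// divff ?gt_eqF// mul1r.
  have -> : expR (- t ^+ 2 / (s ^+ 2 *+ 2)) =
            expR (- t ^+ 2 / (s' ^+ 2 *+ 2)) * expR (- (k * t ^+ 2)).
    by rewrite -expRD; congr expR; rewrite /k; ring.
  set E := expR (- t ^+ 2 / _); have E0 : 0 < E by exact: expR_gt0.
  set u := k * t ^+ 2; have u0 : 0 <= u by rewrite mulr_ge0 ?sqr_ge0// ltW.
  have : (1 + u) * expR (- u) <= 1.
    by rewrite expRN ler_pdivrMr ?expR_gt0// mul1r expR_ge1Dx.
  move=> /(ler_wpM2l (ltW (mulr_gt0 p0 E0))) h.
  rewrite [leRHS](_ : _ = p * E * 1); last by ring.
  rewrite [leLHS](_ : _ = p * E * ((1 + u) * expR (- u)))//.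
  by rewrite /u; ring.
have mpdf a : measurable_fun setT (fun t : R => (normal_pdf 0 a t)%:E).
  by apply/measurable_EFinP; exact: measurable_normal_pdf.
have mt2 : measurable_fun setT (fun t : R => (t ^+ 2 * normal_pdf 0 s t)%:E).
  apply/measurable_EFinP; apply: measurable_funM; last exact: measurable_normal_pdf.
  exact: measurable_funX.
have : (k%:E * M + 1 <= (s' / s)%:E * 1)%E.
  rewrite -{1}(integral_normal_pdf 0 s) -(integral_normal_pdf 0 s').
  rewrite -!ge0_integralZl_EFin//; first last.
  - exact: ltW.
  - by move=> t _; rewrite lee_fin mulr_ge0 ?sqr_ge0 ?normal_pdf_ge0.
  - by rewrite divr_ge0 ?ltW.
  - exact: mpdf.
  - by move=> t _; rewrite lee_fin normal_pdf_ge0.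
  rewrite -ge0_integralD//; first last.
  - exact: mpdf.
  - by move=> t _; rewrite lee_fin normal_pdf_ge0.
  - exact: measurable_funeM.
  - move=> t _; rewrite -EFinM lee_fin mulr_ge0 ?(ltW k0)//.
    by rewrite mulr_ge0 ?sqr_ge0 ?normal_pdf_ge0.
  apply: ge0_le_integral => //.
  - move=> t _; rewrite -EFinM -EFinD lee_fin addr_ge0 ?normal_pdf_ge0//.
    by rewrite mulr_ge0 ?(ltW k0)// mulr_ge0 ?sqr_ge0 ?normal_pdf_ge0.
  - by apply: emeasurable_funD => //; [exact: measurable_funeM|exact: mpdf].
  - by apply: measurable_funeM; exact: mpdf.
  - by move=> t _; rewrite -!EFinM -EFinD lee_fin key.
rewrite mule1; move: M M0 {mt2} => [M||] // M0; last first.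
  by rewrite mulry gtr0_sg// mul1e.
rewrite -EFinM -EFinD !lee_fin => h.
rewrite -s'2; suff : k * M <= k * s' ^+ 2 by rewrite ler_pM2l.
have -> : k * s' ^+ 2 = (s' - s) / s * ((s' + s) / (s *+ 2)).
  by rewrite /k; field; rewrite ?gt_eqF.
apply: (@le_trans _ _ ((s' - s) / s)).
  by rewrite [leRHS]mulrBl divff ?gt_eqF// lerBrDr.
rewrite ler_peMr//; first by rewrite divr_ge0 ?ltW ?subr_gt0.
by rewrite ler_pdivlMr ?mulrn_wgt0// mul1r mulr2n lerD2r ltW.
Qed.

(** The density of the centred Gaussian law with covariance [s] times the
    identity. *)
Definition gauss (s : R) d (x : 'rV[R]_d) : R :=
  normal_peak (Num.sqrt s) ^+ d * expR (- (enorm x ^+ 2 / (s *+ 2))).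

Lemma gaussian_pdf_scalar (s : R) d (x : 'rV[R]_d) : 0 < s ->
  gaussian_pdf 0 s%:M x = gauss s x.
Proof.
move=> s0; rewrite /gaussian_pdf /gauss det_scalar subr0; congr (_ * _).
  rewrite /normal_peak sqr_sqrtr ?ltW// exprVn -exprMn; congr _^-1.
  have -> : s * pi *+ 2 = 2 * pi * s by ring.
  have : 0 <= 2 * pi * s by rewrite mulr_ge0 ?ltW// mulr_gt0 ?pi_gt0.
  elim: d {x} (2 * pi * s) => [|n IH] a a0; first by rewrite !expr0 sqrtr1.
  by rewrite !exprS sqrtrM// IH.
congr expR; rewrite invmx_scalar mul_mx_scalar -scalemxAl mxE mxE.
rewrite enorm_sqr mulNr; congr (- _).
under eq_bigr do rewrite mxE -expr2.
by rewrite mulrC mulrA mulrC [in RHS]mulrC -[s *+ 2]mulr_natl invfM; ring.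
Qed.

Lemma gauss_ge0 s d (x : 'rV[R]_d) : 0 <= gauss s x.
Proof. by rewrite mulr_ge0 ?expR_ge0 ?exprn_ge0 ?normal_peak_ge0. Qed.

Lemma gauss_gt0 s d (x : 'rV[R]_d) : 0 < s -> 0 < gauss s x.
Proof.
move=> s0; rewrite mulr_gt0 ?expR_gt0 ?exprn_gt0 ?normal_peak_gt0//.
by rewrite gt_eqF ?sqrtr_gt0.
Qed.

Lemma measurable_gauss s d : measurable_fun setT (@gauss s d).
Proof.
apply: measurable_funM => //; apply: (measurableT_comp (@measurable_expR R)).
apply: measurableT_comp => //; apply: measurable_funM => //.
exact: measurable_enorm_sqr.
Qed.

Lemma gauss_row_cons s d (t : R) (v : 'rV[R]_d) : 0 < s ->
  gauss s (row_cons (t, v)) = normal_pdf 0 (Num.sqrt s) t * gauss s v.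
Proof.
move=> s0; rewrite /gauss normal_pdfE ?gt_eqF ?sqrtr_gt0// /normal_fun.
rewrite enorm_sqr_row_cons exprS subr0 (@sqr_sqrtr _ s) ?ltW//.
by rewrite mulrDl opprD expRD mulNr; ring.
Qed.

Let mEgauss s d : measurable_fun setT (fun x : 'rV[R]_d => (gauss s x)%:E).
Proof. by apply/measurable_EFinP; exact: measurable_gauss. Qed.

Let m2gauss s d :
  measurable_fun setT (fun x : 'rV[R]_d => (enorm x ^+ 2 * gauss s x)%:E).
Proof.
apply/measurable_EFinP; apply: measurable_funM; last exact: measurable_gauss.
exact: measurable_enorm_sqr.
Qed.

Let mEpdf a : measurable_fun setT (fun t : measurableTypeR R => (normal_pdf 0 a t)%:E).
Proof. by apply/measurable_EFinP; exact: measurable_normal_pdf. Qed.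

Lemma integral_gauss s d : 0 < s -> (\int[lebesgue_rV d]_x (gauss s x)%:E = 1)%E.
Proof.
move=> s0; elim: d => [|d IH].
  rewrite /= integral_dirac//; last exact: mEgauss.
  rewrite diracE mem_set// mul1e /gauss expr0 mul1r.
  by rewrite enorm_sqr big_ord0 mul0r oppr0 expR0.
rewrite ge0_integral_lebesgue_rVS//; last first.
  by move=> x; rewrite lee_fin gauss_ge0.
rewrite -[RHS](integral_normal_pdf 0 (Num.sqrt s)); apply: eq_integral => t _.
under eq_integral do rewrite gauss_row_cons// EFinM.
rewrite ge0_integralZl_EFin ?IH ?mule1 ?normal_pdf_ge0//.
by move=> x _; rewrite lee_fin gauss_ge0.
Qed.

Lemma gauss_second_moment_le s d : 0 < s ->
  (\int[lebesgue_rV d]_x (enorm x ^+ 2 * gauss s x)%:E <= (d%:R * s)%:E)%E.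
Proof.
move=> s0; elim: d => [|d IH].
  rewrite /= integral_dirac//; last exact: m2gauss.
  rewrite diracE mem_set// mul1e enorm_sqr big_ord0 !mul0r.
  by [].
rewrite ge0_integral_lebesgue_rVS//; last first.
  by move=> x; rewrite lee_fin mulr_ge0 ?sqr_ge0 ?gauss_ge0.
set I := (\int[lebesgue_rV d]_x (enorm x ^+ 2 * gauss s x)%:E)%E in IH *.
have I0 : (0 <= I)%E.
  by apply: integral_ge0 => x _; rewrite lee_fin mulr_ge0 ?sqr_ge0 ?gauss_ge0.
rewrite (eq_integral (fun t : measurableTypeR R =>
    (t ^+ 2 * normal_pdf 0 (Num.sqrt s) t)%:E +
    (normal_pdf 0 (Num.sqrt s) t)%:E * I)%E); last first.
  move=> t _.
  under eq_integral => v _.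
    rewrite enorm_sqr_row_cons gauss_row_cons//.
    rewrite (_ : (_ * _)%:E =
      ((t ^+ 2 * normal_pdf 0 (Num.sqrt s) t)%:E * (gauss s v)%:E +
       (normal_pdf 0 (Num.sqrt s) t)%:E * (enorm v ^+ 2 * gauss s v)%:E)%E).
      over.
    by rewrite -!EFinM -EFinD; congr _%:E; ring.
  have p0 : 0 <= t ^+ 2 * normal_pdf 0 (Num.sqrt s) t.
    by rewrite mulr_ge0 ?sqr_ge0 ?normal_pdf_ge0.
  rewrite ge0_integralD//; first last.
  - exact: measurable_funeM.
  - move=> v _; rewrite -EFinM lee_fin mulr_ge0 ?normal_pdf_ge0//.
    by rewrite mulr_ge0 ?sqr_ge0 ?gauss_ge0.
  - exact: measurable_funeM.
  - by move=> v _; rewrite -EFinM lee_fin mulr_ge0 ?gauss_ge0.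
  rewrite !ge0_integralZl_EFin ?normal_pdf_ge0 ?integral_gauss ?mule1//.
  - by move=> v _; rewrite lee_fin mulr_ge0 ?sqr_ge0 ?gauss_ge0.
  - by move=> v _; rewrite lee_fin gauss_ge0.
have m2 : measurable_fun setT (fun t : measurableTypeR R =>
    (t ^+ 2 * normal_pdf 0 (Num.sqrt s) t)%:E).
  apply/measurable_EFinP; apply: measurable_funM; last exact: measurable_normal_pdf.
  exact: measurable_funX.
rewrite ge0_integralD//; first last.
- by apply: emeasurable_funM => //; exact: mEpdf.
- by move=> t _; rewrite mule_ge0// lee_fin normal_pdf_ge0.
- by move=> t _; rewrite lee_fin mulr_ge0 ?sqr_ge0 ?normal_pdf_ge0.
rewrite ge0_integralZr//; last first.
  by move=> t _; rewrite lee_fin normal_pdf_ge0.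
rewrite integral_normal_pdf mul1e -natr1 mulrDl mul1r addrC EFinD.
apply: leeD => //.
have := @normal_second_moment_le (Num.sqrt s).
by rewrite sqrtr_gt0 (@sqr_sqrtr _ s (ltW s0)) => /(_ s0).
Qed.

Lemma gaussian_second_moment_le s d (eta : probability 'rV[R]_d R) : 0 < s ->
  gaussian_law 0 s%:M eta -> (second_moment eta <= (d%:R * s)%:E)%E.
Proof.
move=> s0 g; rewrite /second_moment (ge0_integral_density g).
- apply: le_trans (gauss_second_moment_le d s0).
  rewrite le_eqVlt; apply/orP; left; apply/eqP; apply: eq_integral => x _.
  by rewrite -EFinM gaussian_pdf_scalar.
- by apply/measurable_EFinP; exact: measurable_enorm_sqr.
- by move=> x; rewrite lee_fin sqr_ge0.
Qed.

Section gauss_prob.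
Variables (s : R) (s0 : 0 < s) (d : nat).

(** The probability measure with density [gauss s]. *)
Definition gauss_prob (A : set 'rV[R]_d) : \bar R :=
  (\int[lebesgue_rV d]_(x in A) (gauss s x)%:E)%E.

Let gauss_prob0 : gauss_prob set0 = 0%E.
Proof. by rewrite /gauss_prob integral_set0. Qed.

Let gauss_prob_ge0 A : (0 <= gauss_prob A)%E.
Proof. by apply: integral_ge0 => x _; rewrite lee_fin gauss_ge0. Qed.

Let gauss_prob_sigma_additive : semi_sigma_additive gauss_prob.
Proof.
move=> F mF tF mUF; rewrite /gauss_prob ge0_integral_bigcup//.
- apply: is_cvg_ereal_nneg_natsum_cond => n _ _.
  exact: gauss_prob_ge0.
- apply: measurable_funTS; exact: mEgauss.
- by move=> x _; rewrite lee_fin gauss_ge0.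
Qed.

HB.instance Definition _ := isMeasure.Build _ _ _ gauss_prob
  gauss_prob0 gauss_prob_ge0 gauss_prob_sigma_additive.

Let gauss_probT : gauss_prob setT = 1%E.
Proof. exact: integral_gauss. Qed.

HB.instance Definition _ := Measure_isProbability.Build _ _ _ gauss_prob gauss_probT.

Lemma gaussian_law_exists :
  exists eta : probability 'rV[R]_d R, gaussian_law 0 s%:M eta.
Proof.
exists gauss_prob.
have gE : gaussian_pdf 0 s%:M = @gauss s d.
  by apply/funext => x; rewrite gaussian_pdf_scalar.
split=> //; rewrite gE; first exact: measurable_gauss.
  by move=> x; exact: gauss_ge0.
by [].
Qed.

End gauss_prob.

End gaussian.

(** * Function algebras closed under partial derivatives *)

Section differentiation.
Context {R : realType} {d : nat}.
Implicit Types (f g : 'rV[R]_d -> R) (U : set 'rV[R]_d).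

(** The algebra of functions generated by the set [G] and the coordinate
    functions. *)
Inductive alg (G : set ('rV[R]_d -> R)) : ('rV[R]_d -> R) -> Prop :=
| alg_gen g : G g -> alg G g
| alg_cst c : alg G (fun=> c)
| alg_coord i : alg G (fun x => x 0 i)
| alg_add f g : alg G f -> alg G g -> alg G (fun x => f x + g x)
| alg_mul f g : alg G f -> alg G g -> alg G (fun x => f x * g x).

Lemma alg_opp G f : alg G f -> alg G (fun x => - f x).
Proof.
move=> Gf; rewrite (_ : (fun x => - f x) = (fun x => -1 * f x)).
  by apply: alg_mul => //; exact: alg_cst.
by apply/funext => x; rewrite mulN1r.
Qed.

Lemma is_derive_coord (x v : 'rV[R]_d) i :
  is_derive x v (fun y : 'rV[R]_d => y 0 i) (v 0 i).
Proof.
have df : differentiable (fun y : 'rV[R]_d => y 0 i : R) x.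
  exact: differentiable_coord.
apply: DeriveDef; first exact: diff_derivable.
rewrite /derive; apply: cvg_lim => //; apply: cvg_near_cst.
near=> h.
have h0 : h != 0 by near: h; exact: nbhs_dnbhs_neq.
rewrite /= !mxE addrK /GRing.scale /= mulrA mulVf// mul1r.
by [].
Unshelve. all: by end_near. Qed.

(** Chain rule for the composition of a real function after a function on
    R^d. *)
Lemma is_derive_comp_real (g : R -> R) f (x v : 'rV[R]_d) (dg df : R) :
    differentiable f x -> is_derive x v f df -> is_derive (f x) 1 g dg ->
  differentiable (g \o f) x /\ is_derive x v (g \o f) (dg * df).
Proof.
move=> dfx [_ vf] [dgx vg].
have dg1 : differentiable g (f x) by exact/derivable1_diffP.
have dgf : differentiable (g \o f) x by exact: differentiable_comp.
split=> //; apply: DeriveDef; first exact: diff_derivable.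
rewrite deriveE// diff_comp//= -(deriveE v dfx) vf.
rewrite -[X in 'd g _ X]mulr1 -[df * 1]/(df *: (1 : R)) linearZ /=.
rewrite -(deriveE (1 : R^o) dg1) vg.
by rewrite mulrC.
Qed.

(** If the derivatives of the generators belong to the algebra on [U], then so
    do the derivatives of all its members. *)
Lemma alg_derive G U : (forall g x, G g -> U x -> differentiable g x) ->
    (forall g i, G g -> exists2 g', alg G g' &
       forall x, U x -> 'D_(basis_vec i) g x = g' x) ->
  forall f, alg G f -> (forall x, U x -> differentiable f x) /\
    forall i, exists2 f', alg G f' & forall x, U x -> 'D_(basis_vec i) f x = f' x.
Proof.
move=> dG DG f; elim=> {f}[g Gg|c|i|f g _ [df Df] _ [dg Dg]|f g Gf [df Df] Gg [dg Dg]].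
- by split=> [x Ux|i]; [exact: dG|exact: DG].
- split=> [x _|i]; first exact: differentiable_cst.
  by exists (fun=> 0) => [|x _]; [exact: alg_cst|rewrite derive_cst].
- split=> [x _|j]; first exact: differentiable_coord.
  exists (fun=> basis_vec j 0 i) => [|x _]; first exact: alg_cst.
  by have [_ ->] := is_derive_coord x (basis_vec j) i.
- split=> [x Ux|i]; first by apply: differentiableD; [exact: df|exact: dg].
  have [f' Gf' Df'] := Df i; have [g' Gg' Dg'] := Dg i.
  exists (fun x => f' x + g' x) => [|x Ux]; first exact: alg_add.
  by rewrite deriveD ?Df' ?Dg'//; apply: diff_derivable; [exact: df|exact: dg].
- split=> [x Ux|i]; first by apply: differentiableM; [exact: df|exact: dg].
  have [f' Gf' Df'] := Df i; have [g' Gg' Dg'] := Dg i.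
  exists (fun x => f x * g' x + g x * f' x) => [|x Ux].
    by apply: alg_add; exact: alg_mul.
  by rewrite deriveM ?Df' ?Dg'//; apply: diff_derivable; [exact: df|exact: dg].
Qed.

Lemma near_eq_continuous_at f g (x : 'rV[R]_d) : {near x, f =1 g} ->
  {for x, continuous f} -> {for x, continuous g}.
Proof.
move=> fg; rewrite /prop_for /continuous_at (nbhs_singleton fg).
apply: cvg_trans; apply: (@near_eq_cvg _ _ (nbhs x) _ f g) => //.
Qed.

(** A family of continuous functions that is closed under partial derivatives
    on an open set consists of smooth functions. *)
Lemma partials_closed_family (S : set ('rV[R]_d -> R)) U f : open U ->
    (forall g i, S g -> exists2 g', S g' &
       forall x, U x -> is_derive x (basis_vec i) g (g' x)) ->
  S f -> forall s, exists2 g, S g & forall x, U x -> partials s f x = g x.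
Proof.
move=> oU DS Sf; elim=> [|i s [g Sg gE]]; first by exists f.
have [g' Sg' g'E] := DS g i Sg; exists g' => // x Ux /=.
have [_ <-] := g'E x Ux; apply: near_eq_derive.
have : \near x, U x by exact: open_nbhs_nbhs.
by apply: filterS => y; exact: gE.
Qed.

Lemma Ck_on_closed_family (S : set ('rV[R]_d -> R)) U k f : open U ->
    (forall g x, S g -> U x -> {for x, continuous g}) ->
    (forall g i, S g -> exists2 g', S g' &
       forall x, U x -> is_derive x (basis_vec i) g (g' x)) ->
  S f -> Ck_on k U f.
Proof.
move=> oU cS DS Sf.
have nU x : U x -> \near x, U x by move=> Ux; exact: open_nbhs_nbhs.
have H := partials_closed_family oU DS Sf.
split=> [s _ x Ux|s _ i x Ux]; have [g Sg gE] := H s.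
  apply: near_eq_continuous_at (cS _ _ Sg Ux).
  by apply: filterS (nU _ Ux) => y Uy; rewrite gE.
have [g' _ /(_ x Ux) [+ _]] := DS g i Sg.
apply: near_eq_derivable; apply: filterS (nU _ Ux) => y Uy /=.
by rewrite gE.
Qed.

Lemma partials_eq U f g s x : open U -> (forall x, U x -> f x = g x) ->
  U x -> partials s f x = partials s g x.
Proof.
move=> oU fg; elim: s x => [|i s IH] x Ux /=; first exact: fg.
apply: near_eq_derive; have : \near x, U x by exact: open_nbhs_nbhs.
by apply: filterS => y; exact: IH.
Qed.

Lemma Ck_on_eq k U f g : open U -> (forall x, U x -> f x = g x) ->
  Ck_on k U f -> Ck_on k U g.
Proof.
move=> oU fg [cf df].
have nU x : U x -> \near x, U x by move=> Ux; exact: open_nbhs_nbhs.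
have H s x := @partials_eq U f g s x oU fg.
split=> [s ss x Ux|s ss i x Ux].
  apply: near_eq_continuous_at (cf s ss x Ux).
  by apply: filterS (nU _ Ux) => y; exact: H.
apply: near_eq_derivable (df s ss i x Ux).
by apply: filterS (nU _ Ux) => y; exact: H.
Qed.

(** Mean value theorem along a segment. *)
Lemma MVT_rV f (x v : 'rV[R]_d) : (forall y, differentiable f y) ->
  exists2 c, 0 <= c <= 1 & f (x + v) - f x = 'D_v f (x + c *: v).
Proof.
move=> df.
pose F (t : R) := f (x + t *: v).
have dF (t : R) : is_derive t 1 F ('D_v f (x + t *: v)).
  have h1 := is_diff_scalel t v; have h2 := is_diff_cst x t.
  have [dl dlE] := is_diffD h2 h1.
  rewrite -[_ + _]/(fun t : R => x + t *: v) in dl dlE.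
  have dFt : differentiable F t by exact: differentiable_comp.
  apply: DeriveDef; first exact: diff_derivable.
  rewrite deriveE// diff_comp// dlE /= add0r scale1r.
  by rewrite -deriveE.
have [|c] := @MVT_segment R F _ 0 1 ler01 (fun t _ => dF t).
  apply: derivable_within_continuous => t _.
  by have [] := dF t.
rewrite in_itv /= => c01; rewrite /F scale1r scale0r addr0 subr0 mulr1 => E.
by exists c.
Qed.

End differentiation.

(** * Smoothness of Gaussian mollifications *)

Section gaussian_class.
Context {R : realType} {d : nat}.
Implicit Types (f g : 'rV[R]_d -> R).

Lemma coord_le_norm (x : 'rV[R]_d) i : `|x 0 i| <= `|x|.
Proof.
rewrite [leRHS]/Num.norm /= mx_normrE.
by apply/bigmax_geP; right => /=; exists (ord0, i).
Qed.

Lemma norm_le_enorm (x : 'rV[R]_d) : `|x| <= enorm x.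
Proof.
rewrite [leLHS]/Num.norm /= mx_normrE; apply/bigmax_leP; split; first exact: enorm_ge0.
move=> [i j] _ /=; rewrite (ord1 i) -sqrtr_sqr ler_wsqrtr//.
by rewrite (bigD1 j)//= lerDl sumr_ge0// => k _; exact: sqr_ge0.
Qed.

Lemma continuous_measurable_rV f : continuous f -> measurable_fun setT f.
Proof.
move=> cf; apply: (measurability _ (RGenOpens.measurableE R)) => _ [_ [a [b ->]] <-].
rewrite setTI; apply: open_measurable_rV; apply: open_comp.
  by move=> v _; exact: cf.
exact: interval_open.
Qed.

Lemma differentiable_enorm_sqr (x : 'rV[R]_d) :
  differentiable (fun x : 'rV[R]_d => enorm x ^+ 2) x /\
  forall v, is_derive x v (fun x : 'rV[R]_d => enorm x ^+ 2)
    (2 * \sum_(i < d) x 0 i * v 0 i).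
Proof.
have -> : (fun x : 'rV[R]_d => enorm x ^+ 2) =
    \sum_(i < d) (fun x : 'rV[R]_d => x 0 i) ^+ 2.
  by apply/funext => y; rewrite enorm_sqr fct_sumE.
split.
  apply: differentiable_sum => i; apply: differentiableX.
  exact: differentiable_coord.
move=> v; have H (i : 'I_d) := is_deriveX 2 (is_derive_coord x v i).
apply: (is_derive_eq (is_derive_sum H)).
rewrite mulr_sumr; apply: eq_bigr => i _ /=.
by rewrite expr1 /GRing.scale /= mulrA.
Qed.

(** The products of a polynomial and of the function [exp (- a |x|^2)]. *)
Definition gauss_class (a : R) f := exists2 p, alg set0 p &
  f = fun x => p x * expR (- (a * enorm x ^+ 2)).

Lemma differentiable_gauss_exp a (x : 'rV[R]_d) :
  differentiable (fun x : 'rV[R]_d => expR (- (a * enorm x ^+ 2))) x /\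
  forall v, is_derive x v (fun x : 'rV[R]_d => expR (- (a * enorm x ^+ 2)))
    (- (2 * a) * (\sum_(i < d) x 0 i * v 0 i) * expR (- (a * enorm x ^+ 2))).
Proof.
have [dn Dn] := differentiable_enorm_sqr x.
pose q (x : 'rV[R]_d) := (- a) *: (enorm x ^+ 2 : R^o).
have -> : (fun x : 'rV[R]_d => expR (- (a * enorm x ^+ 2))) = expR \o q.
  by apply/funext => y; rewrite /q /GRing.scale /= mulNr.
have dq : differentiable q x by exact: differentiableZ.
have Dq v : is_derive x v q (- a * (2 * \sum_(i < d) x 0 i * v 0 i)).
  exact: (@is_deriveZ _ _ _ (fun x : 'rV[R]_d => enorm x ^+ 2 : R^o)
    (- a) x v _ (Dn v)).
split=> [|v]; have [h1 h2] := is_derive_comp_real dq (Dq 0) (is_derive_expR (q x)).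
  exact: h1.
have [_ h3] := is_derive_comp_real dq (Dq v) (is_derive_expR (q x)).
by apply: is_derive_eq h3 _; rewrite /= /q /GRing.scale /= mulNr; ring.
Qed.

Lemma alg0_derive f : alg set0 f -> (forall x, differentiable f x) /\
  forall i, exists2 f', alg set0 f' & forall x, 'D_(basis_vec i) f x = f' x.
Proof.
move=> af; have [|g i|h1 h2] := @alg_derive R d set0 setT _ _ f af => //.
split=> [x|i]; first exact: h1.
by have [f' af' f'E] := h2 i; exists f' => // x; exact: f'E.
Qed.

Lemma gauss_class_derive a f : gauss_class a f -> (forall x, differentiable f x) /\
  forall i, exists2 f', gauss_class a f' & forall x, 'D_(basis_vec i) f x = f' x.
Proof.
move=> [p /[dup] ap /alg0_derive[dp Dp] ->]; split=> [x|i].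
  by apply: differentiableM => //; have [] := differentiable_gauss_exp a x.
have [p' ap' p'E] := Dp i.
exists (fun x => (p x * (- (2 * a) * x 0 i) + p' x) * expR (- (a * enorm x ^+ 2))).
  eexists; last reflexivity.
  apply: alg_add => //; apply: alg_mul => //; apply: alg_mul; first exact: alg_cst.
  exact: alg_coord.
move=> x; have [dE DE] := differentiable_gauss_exp a x.
rewrite deriveM; first last.
- exact: diff_derivable.
- exact: diff_derivable.
rewrite p'E; have [_ ->] := DE (basis_vec i).
rewrite (bigD1 i)//= mxE !eqxx mulr1 big1 ?addr0.
  by rewrite /GRing.scale /=; ring.
by move=> j ji; rewrite mxE (negbTE ji) andbF mulr0.
Qed.

(** Polynomials have at most polynomial growth. *)
Lemma alg0_growth f : alg set0 f ->
  exists C m, forall x, `|f x| <= C * (1 + enorm x ^+ 2) ^+ m.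
Proof.
have h1 (x : 'rV[R]_d) : 1 <= 1 + enorm x ^+ 2 by rewrite lerDl sqr_ge0.
have h0 (x : 'rV[R]_d) : 0 <= 1 + enorm x ^+ 2 by rewrite addr_ge0 ?sqr_ge0.
have hC C m (x : 'rV[R]_d) :
    C * (1 + enorm x ^+ 2) ^+ m <= `|C| * (1 + enorm x ^+ 2) ^+ m.
  by rewrite ler_wpM2r ?exprn_ge0// ler_norm.
elim=> {f}[//|c|i|f g _ [C [m fC]] _ [C' [m' gC]]|f g _ [C [m fC]] _ [C' [m' gC]]].
- by exists `|c|, 0%N => x; rewrite expr0 mulr1.
- exists 1, 1%N => x; rewrite mul1r expr1.
  have := le_trans (coord_le_norm x i) (norm_le_enorm x).
  by have := enorm_ge0 x; nra.
- exists (`|C| + `|C'|), (m + m')%N => x; rewrite mulrDl.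
  apply: le_trans (ler_normD _ _) _; apply: lerD.
    apply: le_trans (fC x) _; apply: le_trans (hC _ _ _) _.
    by rewrite ler_wpM2l// ler_weXn2l ?leq_addr.
  apply: le_trans (gC x) _; apply: le_trans (hC _ _ _) _.
  by rewrite ler_wpM2l// ler_weXn2l ?leq_addl.
- exists (`|C| * `|C'|), (m + m')%N => x; rewrite exprD mulrACA normrM.
  apply: ler_pM => //; first exact: le_trans (fC x) (hC _ _ _).
  exact: le_trans (gC x) (hC _ _ _).
Qed.

Lemma gauss_class_bounded a f : 0 < a -> gauss_class a f ->
  exists M, forall x, `|f x| <= M.
Proof.
move=> a0 [p /alg0_growth[C [m pC]] ->].
suff [K KP] : exists K, forall t : R, 0 <= t -> (1 + t) ^+ m * expR (- (a * t)) <= K.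
  exists (`|C| * K) => x; rewrite normrM (ger0_norm (expR_ge0 _)).
  apply: (@le_trans _ _ (C * (1 + enorm x ^+ 2) ^+ m * expR (- (a * enorm x ^+ 2)))).
    by rewrite ler_wpM2r ?expR_ge0.
  rewrite -mulrA; apply: le_trans (ler_wpM2l (normr_ge0 C) (KP _ (sqr_ge0 (enorm x)))).
  rewrite ler_wpM2r ?ler_norm// mulr_ge0 ?expR_ge0// exprn_ge0// addr_ge0//.
  exact: sqr_ge0.
(* 1 + t <= K (1 + a t / (m + 1)) <= K exp (a t / (m + 1)) *)
pose b := a / m.+1%:R; have b0 : 0 < b by rewrite divr_gt0.
pose K := 1 + b^-1; have K1 : 1 <= K by rewrite lerDl invr_ge0 ltW.
have K0 : 0 <= K by exact: le_trans K1.
exists (K ^+ m) => t t0.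
have h : 1 + t <= K * expR (b * t).
  apply: le_trans (ler_wpM2l K0 (expR_ge1Dx _)).
  rewrite mulrDr mulr1 lerD// /K mulrDl mul1r mulKf ?gt_eqF//.
  by rewrite lerDr mulr_ge0// ltW.
apply: (@le_trans _ _ ((K * expR (b * t)) ^+ m * expR (- (a * t)))).
  by rewrite ler_wpM2r ?expR_ge0// lerXn2r// nnegrE ?addr_ge0// mulr_ge0 ?expR_ge0.
rewrite exprMn -mulrA ler_piMr ?exprn_ge0// -expRM_natl -expRD -[leRHS]expR0.
rewrite ler_expR subr_le0.
rewrite mulrA ler_wpM2r// /b mulrCA ler_piMr ?(ltW a0)//.
by rewrite ler_pdivrMr// mul1r ler_nat.
Qed.

Lemma gauss_class_continuous a f : gauss_class a f -> continuous f.
Proof.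
by move=> /gauss_class_derive[df _] x; exact: differentiable_continuous.
Qed.

Lemma gauss_class_measurable a f : gauss_class a f -> measurable_fun setT f.
Proof. by move=> /gauss_class_continuous; exact: continuous_measurable_rV. Qed.

Lemma derive_basis f (x v : 'rV[R]_d) : differentiable f x ->
  'D_v f x = \sum_(i < d) v 0 i * 'D_(basis_vec i) f x.
Proof.
move=> df; rewrite deriveE// {1}(row_sum_delta v) linear_sum.
by apply: eq_bigr => i _; rewrite linearZ /= deriveE.
Qed.

Lemma gauss_class_lipschitz a f : 0 < a -> gauss_class a f ->
  exists2 L, 0 <= L & forall x v, `|f (x + v) - f x| <= L * `|v|.
Proof.
move=> a0 /gauss_class_derive[df Df].
have /choice[M MP] : forall i, exists M, forall x, `|'D_(basis_vec i) f x| <= M.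
  move=> i; have [f' /(gauss_class_bounded a0)[M MP] f'E] := Df i.
  by exists M => x; rewrite f'E.
have M0 i : 0 <= M i by exact: le_trans (MP i 0).
exists (\sum_(i < d) M i) => [|x v]; first exact: sumr_ge0.
have [c _ ->] := MVT_rV x v df.
rewrite derive_basis// mulr_suml; apply: le_trans (ler_norm_sum _ _ _) _.
apply: ler_sum => i _; rewrite normrM mulrC; apply: ler_pM => //.
exact: coord_le_norm.
Qed.

(** First-order Taylor bound along a coordinate axis, uniform in the base
    point. *)
Lemma gauss_class_taylor a f f' i : 0 < a -> gauss_class a f ->
    gauss_class a f' -> (forall x, 'D_(basis_vec i) f x = f' x) ->
  exists2 L, 0 <= L & forall x (h : R),
    `|f (x + h *: basis_vec i) - f x - h * f' x| <= L * h ^+ 2.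
Proof.
move=> a0 gf gf' f'E; have [df _] := gauss_class_derive gf.
have [L L0 LP] := gauss_class_lipschitz a0 gf'; exists L => // x h.
have [c /andP[c0 c1] ->] := MVT_rV x (h *: basis_vec i) df.
have -> : 'D_(h *: basis_vec i) f (x + c *: (h *: basis_vec i)) =
    h * f' (x + c *: (h *: basis_vec i)).
  by rewrite -f'E deriveE// linearZ /= -deriveE.
rewrite -mulrBr normrM -real_normK ?num_real// expr2 mulrCA ler_wpM2l//.
apply: le_trans (LP _ _) _; rewrite ler_wpM2l// scalerA normrZ normrM.
have : `|basis_vec i : 'rV[R]_d| <= 1.
  rewrite [leLHS]/Num.norm /= mx_normrE; apply/bigmax_leP; split => // -[j k] _ /=.
  by rewrite mxE; case: (_ && _); rewrite ?normr1 ?normr0.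
move=> b1; rewrite (ger0_norm c0) mulrAC -[leRHS]mul1r ler_wpM2r//.
by rewrite -[leRHS]mul1r ler_pM.
Qed.

End gaussian_class.

(** Uniform bounds on the members of [gauss_class] pass to their
    mollifications, since [nu] has mass 1. *)
Section mollify_smooth.
Context {R : realType} {d : nat}.
Variables (nu : probability 'rV[R]_d R) (a : R).
Hypothesis a0 : 0 < a.
Implicit Types (f g : 'rV[R]_d -> R).

Lemma integrable_mollify_class f x : gauss_class a f ->
  nu.-integrable setT (EFin \o (fun y => f (x - y))).
Proof.
move=> gf; have [M fM] := gauss_class_bounded a0 gf.
exact: integrable_mollify (gauss_class_measurable gf) fM.
Qed.

Lemma Rintegral_abs_le g (C : R) : nu.-integrable setT (EFin \o g) ->
  (forall y, `|g y| <= C) -> `|Rintegral nu setT g| <= C.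
Proof.
move=> ig gC; apply: le_trans (le_normr_Rintegral measurableT ig) _.
rewrite -[leRHS]mulr1.
have -> : C * 1 = Rintegral nu setT (fun=> C).
  rewrite Rintegral_cst//; congr (_ * _).
  exact/esym/(congr1 fine (probability_setT nu)).
apply: le_Rintegral => //; first exact: integrable_norm.
exact: finite_measure_integrable_cst.
Qed.

Lemma mollify_bounded f : gauss_class a f ->
  exists M, forall x, `|mollify nu f x| <= M.
Proof.
move=> gf; have [M fM] := gauss_class_bounded a0 gf; exists M => x.
by apply: Rintegral_abs_le => //; exact: integrable_mollify_class.
Qed.

Lemma mollify_lipschitz f : gauss_class a f ->
  exists2 L, 0 <= L & forall x v, `|mollify nu f (x + v) - mollify nu f x| <= L * `|v|.
Proof.
move=> gf; have [L L0 fL] := gauss_class_lipschitz a0 gf; exists L => // x v.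
rewrite /mollify -RintegralB//; try exact: integrable_mollify_class.
apply: Rintegral_abs_le => [|y]; last by rewrite addrAC.
exact: (integrableB measurableT (integrable_mollify_class (x + v) gf)
  (integrable_mollify_class x gf)).
Qed.

Lemma mollify_continuous f : gauss_class a f -> continuous (mollify nu f).
Proof.
move=> /mollify_lipschitz[L L0 fL] x.
apply: (proj2 (@cvgrPdist_le _ _ _ (nbhs x) (nbhs_filter x) _ _)) => e e0.
have L1 : 0 < L + 1 by rewrite ltr_wpDl.
apply/nbhs_ballP; exists (e / (L + 1)) => [|y]; first exact: divr_gt0.
rewrite -ball_normE /= => xy.
rewrite distrC -[y](subrKC x); apply: le_trans (fL _ _) _.
apply: (@le_trans _ _ ((L + 1) * `|y - x|)); first by rewrite ler_wpM2r// lerDl.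
by rewrite -ler_pdivlMl// mulrC distrC ltW.
Qed.

Lemma mollify_is_derive f f' i x : gauss_class a f -> gauss_class a f' ->
    (forall x, 'D_(basis_vec i) f x = f' x) ->
  is_derive x (basis_vec i) (mollify nu f) (mollify nu f' x).
Proof.
move=> gf gf' f'E; have [L L0 fL] := gauss_class_taylor a0 gf gf' f'E.
have key (h : R) : `|mollify nu f (x + h *: basis_vec i) - mollify nu f x
     - h * mollify nu f' x| <= L * h ^+ 2.
  have ig y g : gauss_class a g -> nu.-integrable setT (EFin \o (fun z => g (y - z))).
    exact: integrable_mollify_class.
  have iB : nu.-integrable setT (EFin \o
     (fun y => f (x + h *: basis_vec i - y) - f (x - y))).
    by apply: (integrableB measurableT (ig _ _ gf) (ig _ _ gf)).
  have iZ : nu.-integrable setT (EFin \o (fun y => h * f' (x - y))).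
    by apply: (integrableZl measurableT h (ig _ _ gf')).
  rewrite /mollify -RintegralZl//; last exact: ig.
  rewrite -RintegralB//; try exact: ig.
  rewrite -RintegralB//.
  apply: Rintegral_abs_le => [|y]; last first.
    by have := fL (x - y) h; rewrite [x - y + h *: _]addrAC.
  by apply: (integrableB measurableT iB iZ).
have cv : h^-1 *: ((mollify nu f \o shift x) (h *: basis_vec i) - mollify nu f x)
    @[h --> 0^'] --> mollify nu f' x.
  apply/cvgrPdist_le => e e0; near=> h.
  have h0 : h != 0 by near: h; exact: nbhs_dnbhs_neq.
  rewrite /= distrC [_ *: _ + x]addrC /GRing.scale /=.
  rewrite [X in X <= _](_ : _ = `|h|^-1 *
     `|mollify nu f (x + h *: basis_vec i) - mollify nu f x - h * mollify nu f' x|).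
    rewrite ler_pdivrMl ?normr_gt0//; apply: le_trans (key h) _.
    rewrite -real_normK ?num_real// expr2 mulrCA ler_wpM2l//.
    apply: (@le_trans _ _ ((L + 1) * `|h|)); first by rewrite ler_wpM2r// lerDl.
    rewrite -ler_pdivlMl ?ltr_wpDl// mulrC.
    by near: h; apply: dnbhs0_le; rewrite divr_gt0 ?ltr_wpDl.
  rewrite -normfV -normrM; congr `|_|.
  by rewrite [in RHS]mulrBr mulKf.
apply: DeriveDef; first by apply/cvg_ex; exists (mollify nu f' x).
exact: cvg_lim cv.
Unshelve. all: by end_near. Qed.

(** The mollifications by [nu] of the members of [gauss_class]. *)
Definition mollify_class := [set F | exists2 f, gauss_class a f & F = mollify nu f].

Lemma mollify_class_derive F i : mollify_class F -> exists2 F', mollify_class F' &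
  forall x, setT x -> is_derive x (basis_vec i) F (F' x).
Proof.
move=> [f gf ->]; have [_ /(_ i)[f' gf' f'E]] := gauss_class_derive gf.
exists (mollify nu f') => [|x _]; first by exists f'.
exact: mollify_is_derive.
Qed.

(** The exponent 1/2 is arbitrary in (0, 1): on a set of diameter at most [2 r],
    Lipschitz functions are Hoelder with any such exponent. *)
Lemma holder_mollify q (Y : set 'rV[R]_d) (r : R) f : open Y ->
    (forall x, Y x -> enorm x <= r) -> gauss_class a f ->
  holder q 2^-1 Y (mollify nu f).
Proof.
move=> oY Yr gf.
have H (s : seq 'I_d) : exists2 g, gauss_class a g &
    forall x, partials s (mollify nu f) x = mollify nu g x.
  have Sf : mollify_class (mollify nu f) by exists f.
  have [_ [g gg ->] gE] := partials_closed_family openT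
    (fun F i => @mollify_class_derive F i) Sf s.
  by exists g => // x; rewrite gE.
split.
- by apply: continuous_subspaceT; exact: mollify_continuous.
- apply: (@Ck_on_closed_family R d mollify_class Y q) => //.
  + by move=> _ x [g gg ->] _; exact: mollify_continuous.
  + move=> F i /(mollify_class_derive i)[F' SF' F'E].
    by exists F' => // x _; exact: F'E.
  + by exists f.
- move=> s _; have [g gg gE] := H s; have [M gM] := mollify_bounded gg.
  by exists M => x _; rewrite gE.
- move=> s _; have [g gg gE] := H s; have [L L0 gL] := mollify_lipschitz gg.
  exists (L * Num.sqrt (2 * r)) => x y Yx Yy; rewrite !gE.
  have := gL y (x - y); rewrite subrKC => /le_trans; apply.
  rewrite -mulrA ler_wpM2l// powR12_sqrt ?enorm_ge0//.
  apply: le_trans (norm_le_enorm _) _.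
  have r0 : 0 <= r by exact: le_trans (enorm_ge0 x) (Yr _ Yx).
  have t0 := enorm_ge0 (x - y).
  rewrite -{1}[enorm (x - y)]sqr_sqrtr// expr2 ler_wpM2r ?sqrtr_ge0//.
  rewrite ler_wsqrtr// -(ler_pXn2r (n:=2)) ?nnegrE ?mulr_ge0//.
  apply: le_trans (enorm_sqrD_le _ _) _.
  have eN : enorm (- y) = enorm y.
    by rewrite /enorm; congr Num.sqrt; apply: eq_bigr => j _; rewrite mxE sqrrN.
  rewrite eN; have := Yr _ Yx; have := Yr _ Yy.
  have := enorm_ge0 x; have := enorm_ge0 y; nra.
Qed.

End mollify_smooth.

(** * Euclidean balls *)

Section ball_topology.
Context {R : realType} {d : nat}.
Variables (r : R) (r0 : 0 < r).

(** The open Euclidean ball centred at 0. *)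
Definition oball : set 'rV[R]_d := [set x | enorm x < r].

Lemma enorm_ltr_sqr (x : 'rV[R]_d) : (enorm x < r) = (enorm x ^+ 2 < r ^+ 2).
Proof. by rewrite ltr_pXn2r ?nnegrE ?enorm_ge0 ?ltW. Qed.

Lemma enormZ c (x : 'rV[R]_d) : enorm (c *: x) = `|c| * enorm x.
Proof.
rewrite /enorm -sqrtr_sqr -sqrtrM ?sqr_ge0//; congr Num.sqrt.
by rewrite mulr_sumr; apply: eq_bigr => i _; rewrite mxE exprMn.
Qed.

Lemma continuous_enorm_sqr : continuous (fun x : 'rV[R]_d => enorm x ^+ 2).
Proof.
move=> x; apply: differentiable_continuous.
by have [] := differentiable_enorm_sqr x.
Qed.

Lemma continuous_enorm : continuous (@enorm R d).
Proof.
have -> : @enorm R d = Num.sqrt \o (fun x => enorm x ^+ 2).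
  by apply/funext => x /=; rewrite sqrtr_sqr ger0_norm ?enorm_ge0.
move=> x; apply: continuous_comp; first exact: continuous_enorm_sqr.
exact: sqrt_continuous.
Qed.

Lemma open_oball : open oball.
Proof.
have -> : oball = @enorm R d @^-1` [set t | t < r] by [].
by apply: open_comp; [move=> x _; exact: continuous_enorm|exact: open_lt].
Qed.

Lemma closed_eball : closed (eball d r).
Proof.
have -> : eball d r = @enorm R d @^-1` [set t | t <= r] by [].
by apply: closed_comp; [move=> x _; exact: continuous_enorm|exact: closed_le].
Qed.

Lemma closure_oball : closure oball = eball d r.
Proof.
apply/seteqP; split.
  rewrite closureE => x; apply; split; first exact: closed_eball.
  by move=> y /ltW.
move=> x xr B /nbhs_ballP[e /= e0 xeB].
(* [(1 - t) x] is in the open ball, at distance [t |x| < e] from [x] *)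
pose t := e / (e + `|x| + 1).
have D0 : 0 < e + `|x| + 1 by rewrite ltr_wpDl// addr_ge0// ltW.
have t0 : 0 < t by rewrite divr_gt0.
have t1 : t < 1.
  by rewrite ltr_pdivrMr// mul1r -addrA ltrDl ltr_wpDl.
exists ((1 - t) *: x); split.
  rewrite /oball /= enormZ gtr0_norm ?subr_gt0//.
  apply: (@le_lt_trans _ _ ((1 - t) * r)).
    by rewrite ler_wpM2l// subr_ge0 ltW.
  by rewrite gtr_pMl// ltrBlDr ltrDl.
apply: xeB; rewrite -ball_normE /= scalerBl scale1r opprB addrC subrK normrZ.
rewrite gtr0_norm// /t mulrAC ltr_pdivrMr// ltr_pM2l//.
by rewrite -addrA addrCA ltrDl addr_gt0.
Qed.

Lemma bdry_oball p : bdry oball p -> enorm p = r.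
Proof.
move=> [+ cp]; rewrite closure_oball => pr; apply/eqP; rewrite eq_le pr /=.
rewrite leNgt; apply/negP => pr'.
have [q [nq]] := cp _ (open_nbhs_nbhs (conj open_oball pr')).
exact: nq.
Qed.

Lemma bounded_sub_eball (A : set 'rV[R]_d) : A `<=` eball d r -> bounded_set A.
Proof.
move=> Ar; exists r; split; first exact: num_real.
move=> M rM x /= /Ar xr; apply: le_trans (norm_le_enorm x) _.
exact: le_trans xr (ltW rM).
Qed.

Lemma bounded_oball : bounded_set oball.
Proof. by apply: bounded_sub_eball => x /ltW. Qed.

Lemma compact_eball : compact (eball d r).
Proof.
by apply: bounded_closed_compact; [exact: bounded_sub_eball|exact: closed_eball].
Qed.

Lemma oball0 : oball 0.
Proof. by rewrite /oball /= /enorm big1 ?sqrtr0// => i _; rewrite mxE expr0n. Qed.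

Lemma convex_oball : convex_set oball.
Proof.
apply/convex_setW => x y; rewrite !inE /= => xr yr k k0 k1.
have : enorm (k%:num *: (x : 'rV[R]_d) + (1 - k%:num) *: (y : 'rV[R]_d)) < r.
  move: xr yr; rewrite /oball /= !enorm_ltr_sqr => xr yr.
  apply: (@le_lt_trans _ _ (k%:num * enorm x ^+ 2 + (1 - k%:num) * enorm y ^+ 2)).
    rewrite !enorm_sqr !mulr_sumr -big_split /=; apply: ler_sum => i _.
    rewrite !mxE; set s := k%:num in k0 k1 *.
    have := mulr_ge0 (mulr_ge0 (ltW k0) (_ : 0 <= 1 - s)) (sqr_ge0 (x 0 i - y 0 i)).
    by rewrite subr_ge0 => /(_ (ltW k1)); nra.
  by nra.
by move=> H; apply/mem_set; exact: H.
Qed.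

End ball_topology.

Section hemisphere.
Context {R : realType} {n : nat}.
Variables (r : R) (r0 : 0 < r).
Implicit Types u w : 'rV[R]_n.

(** The lower hemisphere of radius [r] is the graph of [- hemi]. *)
Definition hemi u : R := Num.sqrt (r ^+ 2 - enorm u ^+ 2).

(** Derivatives of [hemi] and of [ihemi] are polynomials in the coordinates and
    in [ihemi]. *)
Definition ihemi u : R := (hemi u)^-1.

(** The Euclidean inner product. *)
Definition dotv u w : R := \sum_(i < n) u 0 i * w 0 i.

Lemma hemi_gt0 u : oball r u -> 0 < hemi u.
Proof. by rewrite /oball /= (enorm_ltr_sqr r0) => ur; rewrite sqrtr_gt0 subr_gt0. Qed.

Lemma hemi_derive u : oball r u ->
  differentiable hemi u /\ forall w, is_derive u w hemi (- (dotv u w * ihemi u)).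
Proof.
move=> ur; have h0 := hemi_gt0 ur.
have q0 : 0 < r ^+ 2 - enorm u ^+ 2 by rewrite -sqrtr_gt0.
have [de De] := differentiable_enorm_sqr u.
pose q : 'rV[R]_n -> R := cst (r ^+ 2) - (fun u => enorm u ^+ 2).
have dq : differentiable q u by apply: differentiableB => //; exact: differentiable_cst.
have Dq w : is_derive u w q (0 - 2 * dotv u w).
  exact: is_deriveB (De w).
have ds := is_derive1_sqrt q0.
split=> [|w]; first by have [] := is_derive_comp_real dq (Dq 0) ds.
have [_ H] := is_derive_comp_real dq (Dq w) ds.
apply: is_derive_eq H _; rewrite /ihemi /hemi; field.
by rewrite gt_eqF.
Qed.

Lemma ihemi_derive u : oball r u ->
  differentiable ihemi u /\ forall w, is_derive u w ihemi (dotv u w * ihemi u ^+ 3).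
Proof.
move=> ur; have h0 := hemi_gt0 ur; have hn0 : hemi u != 0 by rewrite gt_eqF.
have [dh Dh] := hemi_derive ur.
split=> [|w]; first exact: differentiableV.
apply: DeriveDef; first by apply: derivableV => //; exact: diff_derivable.
have dhw : derivable hemi u w by exact: diff_derivable.
rewrite /ihemi (deriveV hn0 dhw).
have [_ ->] := Dh w; rewrite /ihemi /GRing.scale /=; field.
exact: hn0.
Qed.

Lemma hemi_smooth k : Ck_on k (@oball R n r) (fun u => - hemi u).
Proof.
pose G := [set f : 'rV[R]_n -> R | f = hemi \/ f = ihemi].
have Gh : alg G hemi by apply: alg_gen; left.
have Gi : alg G ihemi by apply: alg_gen; right.
have dotb u i : dotv u (basis_vec i) = u 0 i.
  rewrite /dotv (bigD1 i)//= mxE !eqxx mulr1 big1 ?addr0// => j ji.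
  by rewrite mxE (negbTE ji) andbF mulr0.
have GD f : alg G f -> (forall u, oball r u -> differentiable f u) /\
   forall i, exists2 f', alg G f' & forall u, oball r u -> 'D_(basis_vec i) f u = f' u.
  apply: alg_derive => [g u [->|->] ur|g i [->|->]].
  - by have [] := hemi_derive ur.
  - by have [] := ihemi_derive ur.
  - exists (fun u => - (u 0 i * ihemi u)) => [|u ur].
      by apply: alg_opp; apply: alg_mul => //; exact: alg_coord.
    by have [_ /(_ (basis_vec i))[_ ->]] := hemi_derive ur; rewrite dotb.
  - exists (fun u => u 0 i * (ihemi u * (ihemi u * ihemi u))) => [|u ur].
      by apply: alg_mul; [exact: alg_coord|do 2 apply: alg_mul => //].
    by have [_ /(_ (basis_vec i))[_ ->]] := ihemi_derive ur; rewrite dotb; ring.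
apply: (@Ck_on_closed_family R n (alg G)).
- exact: open_oball.
- move=> g u /GD[dg _] ur; apply: differentiable_continuous; exact: dg.
- move=> g i /GD[dg /(_ i)[g' Gg' g'E]]; exists g' => // u ur.
  by apply: DeriveDef; [apply: diff_derivable; exact: dg|exact: g'E].
- exact: alg_opp.
Qed.

(** Both sides are equal, because the sphere of radius [r] has all its principal
    curvatures equal to [1 / r]. *)
Lemma hemi_forms u w : oball r u ->
  r^-1 * first_form (fun u => - hemi u) u w <= second_form (fun u => - hemi u) u w.
Proof.
move=> ur.
have Dg v w' : oball r v -> 'D_w' (fun u => - hemi u) v = dotv v w' * ihemi v.
  move=> vr; have [dh /(_ w')[_ Dh]] := hemi_derive vr.
  rewrite (_ : (fun u => - hemi u) = - hemi)// deriveN ?Dh ?opprK//.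
  exact: diff_derivable.
have DDg : 'D_w ('D_w (fun u => - hemi u)) u =
    enorm w ^+ 2 * ihemi u + dotv u w ^+ 2 * ihemi u ^+ 3.
  rewrite (@near_eq_derive _ _ _ _ (dotv^~ w * ihemi)); last first.
    have : \near u, oball r u by apply: open_nbhs_nbhs; split => //; exact: open_oball.
    by apply: filterS => v vr; rewrite Dg.
  have [di /(_ w)[_ Di]] := ihemi_derive ur.
  have dd : is_derive u w (dotv^~ w) (enorm w ^+ 2).
    rewrite (_ : dotv^~ w = \sum_(i < n) (w 0 i *: (fun v : 'rV[R]_n => v 0 i : R^o))).
      have H (i : 'I_n) := is_deriveZ (w 0 i) (is_derive_coord u w i).
      apply: (is_derive_eq (is_derive_sum H)); rewrite enorm_sqr.
      by apply: eq_bigr.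
    by apply/funext => v; rewrite fct_sumE; apply: eq_bigr => i _; rewrite mulrC.
  case: dd => dd ddE.
  rewrite deriveM//; last exact: diff_derivable.
  by rewrite Di ddE /GRing.scale /=; ring.
rewrite /first_form /second_form DDg Dg//.
have k0 : 0 < ihemi u by rewrite invr_gt0 hemi_gt0.
have k2 : (r ^+ 2 - enorm u ^+ 2) * ihemi u ^+ 2 = 1.
  rewrite /ihemi exprVn -[X in X * _]sqr_sqrtr; last first.
    by rewrite ltW// -sqrtr_gt0 hemi_gt0.
  by rewrite divff// sqrf_eq0 gt_eqF// hemi_gt0.
have -> : 1 + \sum_(i < n) 'D_(basis_vec i) (fun u => - hemi u) u ^+ 2 =
    (r * ihemi u) ^+ 2.
  under eq_bigr => i _.
    rewrite Dg// (_ : dotv u (basis_vec i) = u 0 i); last first.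
      rewrite /dotv (bigD1 i)//= mxE !eqxx mulr1 big1 ?addr0// => j ji.
      by rewrite mxE (negbTE ji) andbF mulr0.
    rewrite exprMn; over.
  by rewrite -mulr_suml -enorm_sqr -{1}k2; ring.
rewrite sqrtr_sqr gtr0_norm ?mulr_gt0//.
by rewrite le_eqVlt; apply/orP; left; apply/eqP; field; rewrite !gt_eqF.
Qed.

End hemisphere.

Section ball_domain.
Context {R : realType} {d : nat}.
Variables (r : R) (r0 : 0 < r).

(** The charts of the ball use the matrices [c%:M] with [c * c = 1], that is, the
    identity or its opposite. *)
Lemma enorm_sqr_chart (c : R) (j : 'I_d) (x : 'rV[R]_d) : c * c = 1 ->
  enorm (horizontal c%:M j x) ^+ 2 + height c%:M j x ^+ 2 = enorm x ^+ 2.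
Proof.
move=> c1; rewrite !enorm_sqr addrC (bigD1_ord j)//= /height mul_mx_scalar mxE.
congr (_ + _); first by rewrite exprMn expr2 c1 mul1r.
by apply: eq_bigr => k _; rewrite /horizontal mul_mx_scalar !mxE exprMn expr2 c1 mul1r.
Qed.

Lemma oball_chart k p : enorm p = r -> exists (c : R) (j : 'I_d),
  oball r (horizontal c%:M j p) /\
  graph_chart k (oball r) p c%:M j (fun u => - hemi r u).
Proof.
move=> pr.
have [j pj] : exists j, p 0 j != 0.
  apply/existsP; rewrite -[X in is_true X]negbK negb_exists; apply/negP => /forallP h.
  have : enorm p = 0.
    rewrite /enorm big1 ?sqrtr0// => i _.
    by move: (h i); rewrite negbK => /eqP ->; rewrite expr0n.
  by rewrite pr => r00; move: r0; rewrite r00 ltxx.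
(* [c] is the sign that puts [p] on the lower hemisphere *)
have [c cc cp] : exists2 c : R, c * c = 1 & c * p 0 j < 0.
  case: (ltgtP (p 0 j) 0) pj => // pj _.
    by exists 1; rewrite mul1r.
  by exists (-1); [rewrite mulrNN mulr1|rewrite mulN1r oppr_lt0].
exists c, j.
have hE x : height c%:M j x = c * x 0 j by rewrite /height mul_mx_scalar mxE.
pose N := [set x : 'rV[R]_d | c * x 0 j < 0] `&`
          [set x : 'rV[R]_d | enorm x ^+ 2 - (c * x 0 j) ^+ 2 < r ^+ 2].
have NV x : N x -> oball r (horizontal c%:M j x).
  move=> [_]; rewrite /oball /= (enorm_ltr_sqr r0) -(enorm_sqr_chart j x cc) hE.
  by rewrite addrK.
have Np : N p.
  by split => //=; rewrite pr ltrBlDr ltrDl -sqrrN exprn_gt0// oppr_gt0.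
have cj : continuous (fun x : 'rV[R]_d => c * x 0 j).
  move=> x; apply: (@continuousM _ _ (cst c) (fun x : 'rV[R]_d => x 0 j)).
    exact: cst_continuous.
  exact: coord_continuous.
split; first exact: NV.
split; first by rewrite tr_scalar_mx -scalar_mxM cc.
exists (oball r), N; split => //.
- exact: open_oball.
- apply: openI.
    have -> : [set x : 'rV[R]_d | c * x 0 j < 0] =
      (fun x => c * x 0 j) @^-1` [set t | t < 0] by [].
    by apply: open_comp; [move=> x _; exact: cj|exact: open_lt].
  pose f (x : 'rV[R]_d) := enorm x ^+ 2 - (c * x 0 j) ^+ 2.
  have -> : [set x : 'rV[R]_d | enorm x ^+ 2 - (c * x 0 j) ^+ 2 < r ^+ 2] =
     f @^-1` [set t | t < r ^+ 2] by [].
  apply: open_comp; [move=> x _|exact: open_lt].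
  apply: (@continuousB _ _ _ (fun x : 'rV[R]_d => enorm x ^+ 2)
    (fun x : 'rV[R]_d => (c * x 0 j) ^+ 2)).
    exact: continuous_enorm_sqr.
  exact: (continuousM (cj x) (cj x)).
- exact: hemi_smooth.
move=> x Nx; split; first exact: NV.
have [hx _] := Nx; rewrite /= -hE in hx.
have := enorm_sqr_chart j x cc.
have := hemi_gt0 r0 (NV _ Nx).
have : hemi r (horizontal c%:M j x) ^+ 2 = r ^+ 2 - enorm (horizontal c%:M j x) ^+ 2.
  rewrite sqr_sqrtr// subr_ge0 ltW// -(enorm_ltr_sqr r0); exact: NV.
rewrite /oball /= (enorm_ltr_sqr r0).
move: (hemi _ _) (height _ _ _) (enorm _) (enorm x) hx => h t e e' t0 h2 h0 <-.
split => H.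
  rewrite ltrNl -(ltr_pXn2r (n:=2)) ?nnegrE ?ltW// ?oppr_gt0//.
  by rewrite sqrrN h2; lra.
have : (- t) ^+ 2 < h ^+ 2 by rewrite ltr_pXn2r ?nnegrE ?ltW ?oppr_gt0//; lra.
by rewrite sqrrN h2; lra.
Qed.

Lemma Sq_domain_oball q : Sq_domain q (@oball R d r).
Proof.
split.
- by exists 0; exact: oball0.
- exact: open_oball.
- exact: bounded_oball.
- move=> p /(bdry_oball r0) pr.
  by have [c [j [_ H]]] := oball_chart q.+2 pr; exists c%:M, j, (fun u => - hemi r u).
- split; first exact: convex_oball.
  exists r^-1 => [|p /(bdry_oball r0) pr]; first by rewrite invr_gt0.
  have [c [j [V H]]] := oball_chart 2 pr; exists c%:M, j, (fun u => - hemi r u).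
  by split=> // w; exact: hemi_forms.
Qed.

End ball_domain.

(** * Truncation *)

Section truncation_theory.
Context {R : realType} {d : nat}.
Variables (rho : probability 'rV[R]_d R) (D : set 'rV[R]_d) (mD : measurable D).
Hypothesis D0 : (0 < rho D)%E.

Local Notation p := (fine (rho D)).

Lemma probability_fineE : rho D = p%:E.
Proof. by rewrite fineK// fin_num_measure. Qed.

Lemma probability_fine_gt0 : 0 < p.
Proof. by rewrite -lte_fin -probability_fineE. Qed.

Lemma truncationE A : truncation rho mD A = (rho (A `&` D) * (p^-1)%:E)%E.
Proof.
have E : mrestr rho mD setT = rho D by rewrite /mrestr setTI.
transitivity (mnormalize (mrestr rho mD) rho A) => //.
rewrite /mnormalize [X in X == 0%E]E [X in X == +oo%E]E [X in fine X]E.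
by rewrite gt_eqF//= probability_fineE.
Qed.

Lemma ge0_integral_truncation_le (h : 'rV[R]_d -> \bar R) :
    measurable_fun setT h -> (forall x, 0 <= h x)%E ->
  (\int[truncation rho mD]_x h x <= (p^-1)%:E * \int[rho]_x h x)%E.
Proof.
move=> mh h0; have k0 : 0 <= p^-1 by rewrite invr_ge0 ltW// probability_fine_gt0.
rewrite (eq_measure_integral (mscale (NngNum k0) (mrestr rho mD))); last first.
  by move=> A mA _; apply: (etrans (truncationE A)); rewrite muleC.
rewrite ge0_integral_mscale//= lee_pmul2l//; last first.
  by rewrite lte_fin invr_gt0 probability_fine_gt0.
have mDC := measurableC mD.
rewrite [leRHS](eq_measure_integral (measure_add (mrestr rho mD) (mrestr rho mDC))).
  by rewrite ge0_integral_measure_add// leeDl// integral_ge0.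
move=> A mA _; apply/esym/(etrans (measure_addE _ _ A)).
have := measureU rho (measurableI _ _ mA mD) (measurableI _ _ mA mDC).
rewrite setIACA setICr setI0 -setIUr setUCr setIT => /(_ erefl) H.
exact: esym.
Qed.

Lemma has_density_truncation f : has_density rho f ->
  has_density (truncation rho mD) (fun x => p^-1 * f x * \1_D x).
Proof.
move=> [mf f0 rhoE]; split.
- apply: measurable_funM; last exact: measurable_indic.
  exact: measurable_funM.
- by move=> x; rewrite !mulr_ge0// invr_ge0 ltW// probability_fine_gt0.
move=> A mA; rewrite truncationE rhoE; last exact: measurableI.
rewrite integral_mkcondr muleC -ge0_integralZl//; first last.
- by rewrite lee_fin invr_ge0 ltW// probability_fine_gt0.
- by move=> x _; rewrite patchE; case: ifP; rewrite ?lee_fin.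
- apply/(measurable_restrict _ mD mA); apply: measurable_funTS.
  exact/measurable_EFinP.
apply: eq_integral => x _; rewrite patchE indicE.
by case: ifP => _; rewrite ?mulr1 ?mulr0 ?mule0// EFinM.
Qed.

End truncation_theory.

Section Mq_truncation.
Context {R : realType} {d : nat}.

Lemma holder_eq q al (Y : set 'rV[R]_d) (f g : 'rV[R]_d -> R) : open Y ->
  (forall x, closure Y x -> f x = g x) -> holder q al Y f -> holder q al Y g.
Proof.
move=> oY fg [cf Cf bf hf]; have fgY x : Y x -> f x = g x.
  by move=> Yx; apply: fg; exact: subset_closure.
have pE s x : Y x -> partials s g x = partials s f x.
  by move=> Yx; apply: (@partials_eq R d Y) => // y Yy; rewrite fgY.
split.
- by apply: subspace_eq_continuous cf => x; rewrite inE; exact: fg.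
- exact: Ck_on_eq Cf.
- by move=> s ss; have [M HM] := bf s ss; exists M => x Yx; rewrite pE// HM.
- move=> s ss; have [C HC] := hf s ss; exists C => x y Yx Yy.
  by rewrite !pE// HC.
Qed.

Lemma probability_integral_gt0 (nu : probability 'rV[R]_d R) (h : 'rV[R]_d -> R) :
  measurable_fun setT h -> (forall x, 0 < h x) -> (0 < \int[nu]_x (h x)%:E)%E.
Proof.
move=> mh h0; rewrite lt0e; apply/andP; split; last first.
  by apply: integral_ge0 => x _; rewrite lee_fin ltW.
apply/eqP => I0.
have mEh : measurable_fun setT (EFin \o h) by exact/measurable_EFinP.
have : (\int[nu]_x `|(EFin \o h) x| = 0)%E.
  by rewrite -[RHS]I0; apply: eq_integral => x _ /=; rewrite gtr0_norm.
move=> /(ae_eq_integral_abs nu measurableT mEh)[N [mN N0 sN]].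
have : (nu setT <= nu N)%E.
  apply: le_measure; rewrite ?inE// => x _; apply: sN => /= /(_ Logic.I)[hx].
  by have := h0 x; rewrite hx ltxx.
rewrite N0 leNgt => /negP; apply.
by rewrite [ltRHS](_ : _ = 1%E)//; exact: probability_setT.
Qed.

Lemma gauss_class_gauss (s : R) : gauss_class ((s *+ 2)^-1) (@gauss R s d).
Proof.
exists (fun=> normal_peak (Num.sqrt s) ^+ d); first exact: alg_cst.
by apply/funext => x; rewrite /gauss mulrC [_^-1 * _]mulrC [LHS]mulrC.
Qed.

Lemma gauss_classZ (a c : R) (f : 'rV[R]_d -> R) :
  gauss_class a f -> gauss_class a (fun x => c * f x).
Proof.
move=> [q aq ->]; exists (fun x => c * q x).
  by apply: alg_mul => //; exact: alg_cst.
by apply/funext => x; rewrite mulrA.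
Qed.

(** The truncation to a ball of a law with a Gaussian mollification as density
    is regular. *)
Lemma Mq_truncation (nu rho : probability 'rV[R]_d R) q (s r : R) :
    0 < s -> 0 < r -> P2 rho -> has_density rho (mollify nu (@gauss R s d)) ->
    (0 < rho (eball d r))%E ->
  Mq q (truncation rho (measurable_eball d r)).
Proof.
move=> s0 r0 P2rho Hd rD0.
set D := eball d r; have mD : measurable D by exact: measurable_eball.
set mu := truncation _ _.
have p0 := probability_fine_gt0 mD rD0; set p := fine _ in p0.
pose a := (s *+ 2)^-1; have a0 : 0 < a by rewrite invr_gt0 mulrn_wgt0.
have gc : gauss_class a (@gauss R s d) by exact: gauss_class_gauss.
pose f := mollify nu (@gauss R s d).
have dmu := has_density_truncation (measurable_eball d r) rD0 Hd.
have P2mu : P2 mu.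
  apply: le_lt_trans (ge0_integral_truncation_le _ _ _ _) _ => //.
  - by apply/measurable_EFinP; exact: measurable_enorm_sqr.
  - by move=> x; rewrite lee_fin sqr_ge0.
  - by rewrite lte_mul_pinfty// lee_fin invr_ge0 ltW.
split; first by split; [exact: P2mu|exact: has_density_dominates dmu].
pose g x := p^-1 * f x * \1_D x.
(* the normalising constant is absorbed in the mollified function *)
pose phi (x : 'rV[R]_d) := p^-1 * gauss s x.
have gphi : gauss_class a phi by exact: gauss_classZ.
have [M Mphi] := gauss_class_bounded a0 gphi.
have mphi := gauss_class_measurable gphi.
pose F := mollify nu phi.
have FE x : F x = p^-1 * f x.
  rewrite /F /f /mollify -RintegralZl//.
  by apply: (integrable_mollify_class nu a0 x gc).
have gF x : D x -> g x = F x.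
  by move=> Dx; rewrite /g indicE mem_set// mulr1 FE.
have phi0 x : 0 < phi x by rewrite mulr_gt0 ?invr_gt0// gauss_gt0.
have F0 x : 0 < F x.
  rewrite -lte_fin (mollifyE _ _ mphi Mphi); apply: probability_integral_gt0 => //.
  exact: (measurableT_comp mphi (measurable_sub_rV x)).
have cF : continuous F by exact: (mollify_continuous a0 gphi).
have [N FN] := mollify_bounded nu a0 gphi.
have [c c0 cF'] : exists2 c, 0 < c & forall x, D x -> c <= F x.
  have [|||x0 _ x0P] := @EVT_min_rV R d F D.
  - by exists 0; apply: ltW; exact: oball0.
  - exact: compact_eball.
  - exact: continuous_subspaceT.
  exists (F x0) => [|x Dx]; first exact: F0.
  by apply: x0P; exact: mem_set.
have suppE : supp mu = closure (@oball R d r).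
  rewrite closure_oball//; apply/seteqP; split => x.
    move=> sx; apply: contrapT => nDx.
    have := sx (~` D) (closed_openC (@closed_eball R d r)) nDx.
    by rewrite truncationE// setICl measure0 mul0e ltxx.
  rewrite -closure_oball// => cx U oU Ux.
  have [y [By Uy]] := cx _ (open_nbhs_nbhs (conj oU Ux)).
  have mUB : measurable (U `&` oball r).
    by apply: open_measurable_rV; apply: openI => //; exact: open_oball.
  apply: (@lt_le_trans _ _ (mu (U `&` oball r))); last first.
    apply: le_measure; [exact: mem_set| |by move=> ? []].
    by apply: mem_set; exact: open_measurable_rV.
  have [_ _ ->] := dmu; last by [].
  apply: (@lt_le_trans _ _ (c%:E * lebesgue_rV d (U `&` oball r))%E).
    rewrite mule_gt0 ?lte_fin//; apply: lebesgue_rV_open_gt0; last by exists y.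
    by apply: openI => //; exact: open_oball.
  rewrite -integral_cst//; apply: ge0_le_integral => //.
  - by move=> z _; rewrite lee_fin ltW.
  - apply: measurable_funTS; apply/measurable_EFinP.
    by have [] := dmu.
  - move=> z [_ Bz]; rewrite lee_fin.
    have Dz : D z by exact: ltW.
    by rewrite -/p -/(f z) -/(g z) gF// cF'.
exists (@oball R d r); split => //; first exact: Sq_domain_oball.
exists g; split; first exact: dmu.
pose zeta := 1 + `|N| + c^-1.
have z1 : 1 <= zeta by rewrite /zeta -addrA lerDl addr_ge0// invr_ge0 ltW.
exists 2^-1, zeta; split => //.
- by lra.
- apply: (@holder_eq _ _ _ F); first exact: open_oball.
    by rewrite closure_oball// => x Dx; rewrite gF.
  apply: (@holder_mollify R d nu a a0 q _ r) => //; first exact: open_oball.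
  by move=> x /ltW.
move=> x; rewrite suppE closure_oball// => Dx; rewrite gF//; apply/andP; split.
  apply: le_trans (cF' _ Dx); rewrite invf_ple ?posrE// ?(lt_le_trans ltr01)//.
  by rewrite /zeta lerDr addr_ge0.
apply: le_trans (ler_norm _) _; apply: le_trans (FN x) _.
apply: le_trans (ler_norm _) _.
by rewrite /zeta addrAC lerDr addr_ge0// invr_ge0 ltW.
Qed.

End Mq_truncation.

(** * Transport cost *)

Section W2_bound.
Context {R : realType} {d : nat}.
Implicit Types eta nu rho : probability 'rV[R]_d R.

Let mE2 : measurable_fun setT (fun x : 'rV[R]_d => (enorm x ^+ 2)%:E).
Proof. by apply/measurable_EFinP; exact: measurable_enorm_sqr. Qed.

Let E20 (x : 'rV[R]_d) : (0 <= (enorm x ^+ 2)%:E)%E.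
Proof. by rewrite lee_fin sqr_ge0. Qed.

Lemma ge0_integral_prod_fst d1 d2 (T1 : measurableType d1) (T2 : measurableType d2)
    (P : probability T1 R) (Q : probability T2 R) (f : T1 -> \bar R) :
    measurable_fun setT f -> (forall x, 0 <= f x)%E ->
  (\int[P \x Q]_z f z.1 = \int[P]_x f x)%E.
Proof.
move=> mf f0; rewrite (fubini_tonelli1 (fun z : T1 * T2 => f z.1))//.
  apply: eq_integral => x _; rewrite /fubini_F /= integral_cst//.
  by rewrite [X in (_ * X)%E](_ : _ = 1%E) ?mule1//; exact: probability_setT.
by apply: measurableT_comp => //; exact: measurable_fst.
Qed.

Lemma ge0_integral_prod_snd d1 d2 (T1 : measurableType d1) (T2 : measurableType d2)
    (P : probability T1 R) (Q : probability T2 R) (f : T2 -> \bar R) :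
    measurable_fun setT f -> (forall x, 0 <= f x)%E ->
  (\int[P \x Q]_z f z.2 = \int[Q]_x f x)%E.
Proof.
move=> mf f0; rewrite (fubini_tonelli2 (fun z : T1 * T2 => f z.2))//.
  apply: eq_integral => x _; rewrite /fubini_G /= integral_cst//.
  by rewrite [X in (_ * X)%E](_ : _ = 1%E) ?mule1//; exact: probability_setT.
by apply: measurableT_comp => //; exact: measurable_snd.
Qed.

Lemma ge0_integral_prodM d1 d2 (T1 : measurableType d1) (T2 : measurableType d2)
    (P : probability T1 R) (Q : probability T2 R)
    (f : T1 -> \bar R) (g : T2 -> \bar R) :
    measurable_fun setT f -> (forall x, 0 <= f x)%E ->
    measurable_fun setT g -> (forall x, 0 <= g x)%E ->
  (\int[P \x Q]_z (f z.1 * g z.2) = \int[P]_x f x * \int[Q]_y g y)%E.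
Proof.
move=> mf f0 mg g0.
rewrite (fubini_tonelli1 (fun z : T1 * T2 => f z.1 * g z.2)%E).
- rewrite -ge0_integralZr//; last exact: integral_ge0.
  by apply: eq_integral => x _; rewrite /fubini_F /= ge0_integralZl.
- apply: emeasurable_funM.
    exact: (measurableT_comp mf measurable_fst).
  exact: (measurableT_comp mg measurable_snd).
- by move=> z; exact: mule_ge0.
Qed.

Lemma second_moment_convolution_le eta nu :
  (second_moment (convolution eta nu) <=
   2%:E * second_moment eta + 2%:E * second_moment nu)%E.
Proof.
rewrite /second_moment /convolution ge0_integral_distribution//.
rewrite -(ge0_integral_prod_fst eta nu mE2 E20) -(ge0_integral_prod_snd eta nu mE2 E20).
have m1 : measurable_fun setT (fun z : 'rV[R]_d * 'rV[R]_d => (enorm z.1 ^+ 2)%:E).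
  exact: (measurableT_comp mE2 measurable_fst).
have m2 : measurable_fun setT (fun z : 'rV[R]_d * 'rV[R]_d => (enorm z.2 ^+ 2)%:E).
  exact: (measurableT_comp mE2 measurable_snd).
rewrite -!ge0_integralZl_EFin// -ge0_integralD//; first last.
- exact: measurable_funeM.
- by move=> z _; rewrite -EFinM lee_fin mulr_ge0 ?sqr_ge0.
- exact: measurable_funeM.
- by move=> z _; rewrite -EFinM lee_fin mulr_ge0 ?sqr_ge0.
apply: ge0_le_integral => //.
- by move=> z _; exact: E20.
- exact: (measurableT_comp mE2 (@measurable_vadd R d)).
- by apply: emeasurable_funD; exact: measurable_funeM.
- by move=> z _; rewrite -!EFinM -EFinD lee_fin enorm_sqrD_le.
Qed.

Section coupling.
Variables (eta nu : probability 'rV[R]_d R).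
Let rho := convolution eta nu.
Variables (D : set 'rV[R]_d) (mD : measurable D).
Hypothesis D0 : (0 < rho D)%E.
Let mu := truncation rho mD.
Local Notation p := (fine (rho D)).

Local Notation T := (('rV[R]_d * 'rV[R]_d) * 'rV[R]_d)%type.

(** The sum of the first two components if it lies in [D], and the third
    component otherwise. *)
Definition resample (z : T) : 'rV[R]_d :=
  \1_D (vadd z.1) *: vadd z.1 + (1 - \1_D (vadd z.1)) *: z.2.

Lemma resample_in z : D (vadd z.1) -> resample z = vadd z.1.
Proof.
by move=> Dz; rewrite /resample indicE mem_set// subrr scale0r scale1r addr0.
Qed.

Lemma resample_notin z : ~ D (vadd z.1) -> resample z = z.2.
Proof.
by move=> Dz; rewrite /resample indicE memNset// subr0 scale0r scale1r add0r.
Qed.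

Let mv : measurable_fun setT (fun z : T => vadd z.1).
Proof. exact: (measurableT_comp (@measurable_vadd R d) measurable_fst). Qed.

Let m1D : measurable_fun setT (fun z : T => \1_D (vadd z.1) : R).
Proof. exact: (measurableT_comp (measurable_indic mD) mv). Qed.

(** The resampled point and the point with law [nu]. *)
Definition resample_pair (z : T) : 'rV[R]_d * 'rV[R]_d := (resample z, z.1.2).

Lemma measurable_resample_pair : measurable_fun setT resample_pair.
Proof.
apply/measurable_fun_pairP; split => /=; last first.
  exact: (measurableT_comp measurable_snd measurable_fst).
apply: measurable_fun_rV => i; under eq_fun do rewrite !mxE.
apply: measurable_funD; apply: measurable_funM.
- exact: m1D.
- have := measurableT_comp (measurable_coord i) mv; rewrite /comp /=.
  by under eq_fun do rewrite mxE.
- by apply: measurable_funB.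
- exact: (measurableT_comp (measurable_coord i) measurable_snd).
Qed.

HB.instance Definition _ := isMeasurableFun.Build _ _ _ _
  resample_pair measurable_resample_pair.

(** The coupling of the truncated law and of [nu] that keeps the points of [D]
    and resamples the others independently. *)
Definition resample_coupling : probability ('rV[R]_d * 'rV[R]_d)%type R :=
  distribution ((eta \x nu) \x mu)%E resample_pair.

Lemma resample_couplingP : coupling mu nu resample_coupling.
Proof.
move=> A mA.
have mvA B : measurable B -> measurable (@vadd R d @^-1` B).
  by move=> mB; rewrite -[X in measurable X]setTI; exact: measurable_vadd.
have P1 : ((eta \x nu) setT = 1)%E by exact: probability_setT.
have mu1 : mu setT = 1%E by exact: probability_setT.
pose Q : probability T R := ((eta \x nu) \x mu)%E.
have QE X Y : measurable X -> measurable Y ->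
    Q (X `*` Y) = ((eta \x nu) X * mu Y)%E by exact: product_measure1E.
have mDA := measurableI _ _ mD mA; have mDC := measurableC mD.
split.
  transitivity (Q ((@vadd R d @^-1` (D `&` A) `*` setT) `|`
                   (@vadd R d @^-1` (~` D) `*` A))).
    congr (Q _); apply/seteqP; split => -[z y] /=.
      move=> [Az _]; have [Dz|Dz] := pselect (D (vadd z)).
        by left; split => //; split => //; move: Az; rewrite resample_in.
      by right; split => //; move: Az; rewrite resample_notin.
    move=> [[[Dz Az] _]|[Dz Ay]]; split => //; first by rewrite resample_in.
    by rewrite resample_notin.
  have mX : measurable ((@vadd R d @^-1` (D `&` A)) `*` [set: 'rV[R]_d]).
    by apply: measurableX => //; exact: mvA.
  have mY : measurable ((@vadd R d @^-1` (~` D)) `*` A).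
    by apply: measurableX => //; exact: mvA.
  rewrite (_ : Q _ = (Q ((@vadd R d @^-1` (D `&` A)) `*` setT) +
                      Q ((@vadd R d @^-1` (~` D)) `*` A))%E); last first.
    apply: (measureU Q mX mY); rewrite -subset0 => -[z y] [[[Dz _] _] [nDz _]].
    exact: nDz.
  rewrite QE//; last exact: mvA.
  rewrite QE//; last exact: mvA.
  rewrite [mu setT]mu1 mule1.
  have [x xE] : exists x : R, rho (A `&` D) = x%:E.
    have mAD := measurableI _ _ mA mD.
    by exists (fine (rho (A `&` D))); rewrite fineK// fin_num_measure.
  have p0 := probability_fine_gt0 mD D0.
  have CE : rho (~` D) = (1 - p)%:E.
    by rewrite (probability_setC rho mD) (probability_fineE rho mD).
  transitivity (rho (A `&` D) + rho (~` D) * mu A)%E; first by rewrite setIC.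
  rewrite [mu A](truncationE mD D0 A) CE xE.
  rewrite -!EFinM -EFinD; congr _%:E.
  by field; rewrite gt_eqF.
transitivity (Q ((setT `*` A) `*` setT)).
  by congr (Q _); apply/seteqP; split => -[[z x] y] /=; tauto.
transitivity ((eta \x nu)%E (setT `*` A)).
  by rewrite QE//; [rewrite [mu setT]mu1 mule1|exact: measurableX].
apply: (etrans (product_measure1E eta nu measurableT mA)).
transitivity (1 * nu A)%E; last by rewrite mul1e.
by congr (_ * _)%E; exact: probability_setT.
Qed.

(** The squared distance splits into the contribution of the Gaussian shift and
    that of the resampling, and the second one vanishes on [D]. *)
Lemma resample_cost_pointwise (z : T) :
  enorm (resample z - z.1.2) ^+ 2 <= 2 * enorm z.1.1 ^+ 2 +
   4 * (\1_(~` D) (vadd z.1) * enorm (vadd z.1) ^+ 2 +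
        \1_(~` D) (vadd z.1) * enorm z.2 ^+ 2).
Proof.
have -> : resample z - z.1.2 = z.1.1 + (resample z - vadd z.1).
  by rewrite /vadd opprD [RHS]addrCA addNKr.
apply: le_trans (enorm_sqrD_le _ _) _; rewrite lerD2l.
have en0 : enorm (0 : 'rV[R]_d) = 0 by rewrite -[0](scale0r 0) enormZ normr0 mul0r.
have [Dz|Dz] := pselect (D (vadd z.1)).
  rewrite resample_in// subrr en0 expr0n /= mulr0 indicE memNset ?mul0r ?addr0 ?mulr0//.
rewrite resample_notin// indicE mem_set// !mul1r.
have := enorm_sqrD_le z.2 (- vadd z.1).
have -> : enorm (- vadd z.1) = enorm (vadd z.1).
  by rewrite -scaleN1r enormZ normrN1 mul1r.
by lra.
Qed.

Lemma resample_coupling_cost_le :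
  (\int[resample_coupling]_z (enorm (z.1 - z.2) ^+ 2)%:E <=
   2%:E * second_moment eta +
   4%:E * (\int[rho]_(x in ~` D) (enorm x ^+ 2)%:E +
           rho (~` D) * second_moment mu))%E.
Proof.
rewrite ge0_integral_distribution//; last first.
  exact: (measurableT_comp mE2 (@measurable_sub2_rV R d)).
have mDC := measurableC mD.
have mi : measurable_fun setT (\1_(~` D) : 'rV[R]_d -> R) by exact: measurable_indic.
have mg2 : measurable_fun setT (fun x : 'rV[R]_d => (\1_(~` D) x * enorm x ^+ 2)%:E).
  apply/measurable_EFinP; apply: measurable_funM => //; exact: measurable_enorm_sqr.
have mEi : measurable_fun setT (fun x : 'rV[R]_d => (\1_(~` D) x)%:E : \bar R).
  exact/measurable_EFinP.
pose F1 (z : T) := (enorm z.1.1 ^+ 2)%:E.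
pose F2 (z : T) := (\1_(~` D) (vadd z.1) * enorm (vadd z.1) ^+ 2)%:E.
pose F3 (z : T) := (\1_(~` D) (vadd z.1) * enorm z.2 ^+ 2)%:E.
have mF1 : measurable_fun setT F1.
  exact: (measurableT_comp mE2 (measurableT_comp measurable_fst measurable_fst)).
have mF2 : measurable_fun setT F2 by exact: (measurableT_comp mg2 mv).
have mF3 : measurable_fun setT F3.
  apply/measurable_EFinP; apply: measurable_funM.
    exact: (measurableT_comp mi mv).
  exact: (measurableT_comp (@measurable_enorm_sqr R d) measurable_snd).
have F10 z : (0 <= F1 z)%E by exact: E20.
have F20 z : (0 <= F2 z)%E by rewrite lee_fin mulr_ge0 ?sqr_ge0.
have F30 z : (0 <= F3 z)%E by rewrite lee_fin mulr_ge0 ?sqr_ge0.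
apply: (@le_trans _ _
  (\int[(eta \x nu) \x mu]_z (2%:E * F1 z + 4%:E * (F2 z + F3 z)))%E).
  apply: ge0_le_integral => //.
  - by move=> z _; exact: E20.
  - exact: (measurableT_comp (measurableT_comp mE2 (@measurable_sub2_rV R d))
      measurable_resample_pair).
  - apply: emeasurable_funD; apply: measurable_funeM => //.
    exact: emeasurable_funD.
  - move=> z _; rewrite -[(F2 z + F3 z)%E]EFinD -[(2%:E * F1 z)%E]EFinM.
    rewrite -[(4%:E * _)%E]EFinM -EFinD lee_fin.
    exact: resample_cost_pointwise.
rewrite ge0_integralD//; first last.
- by apply: measurable_funeM; exact: emeasurable_funD.
- by move=> z _; rewrite mule_ge0 ?adde_ge0.
- exact: measurable_funeM.
- by move=> z _; rewrite mule_ge0.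
rewrite !ge0_integralZl_EFin//; first last.
- exact: emeasurable_funD.
- by move=> z _; exact: adde_ge0.
rewrite ge0_integralD//; apply: leeD; last (apply: lee_wpmul2l => //; apply: leeD).
- rewrite (ge0_integral_prod_fst (eta \x nu)%E mu
    (f := fun z => (enorm z.1 ^+ 2)%:E))//.
    by rewrite (ge0_integral_prod_fst eta nu mE2 E20).
  exact: (measurableT_comp mE2 measurable_fst).
- rewrite le_eqVlt; apply/orP; left; apply/eqP.
  rewrite (ge0_integral_prod_fst (eta \x nu)%E mu
    (f := fun z => (\1_(~` D) (vadd z) * enorm (vadd z) ^+ 2)%:E)); first last.
  - by move=> z; rewrite lee_fin mulr_ge0 ?sqr_ge0.
  - exact: (measurableT_comp mg2 (@measurable_vadd R d)).
  rewrite /rho /convolution [RHS]integral_mkcond [RHS]ge0_integral_distribution//.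
  - apply: eq_integral => z _; rewrite /= patchE indicE.
    by case: ifP => _; rewrite ?mul1r ?mul0r.
  - exact/(measurable_restrictT _ mDC)/measurable_funTS.
  - by move=> x; rewrite patchE; case: ifP.
rewrite le_eqVlt; apply/orP; left; apply/eqP.
have mDv : measurable_fun setT
    (fun z : 'rV[R]_d * 'rV[R]_d => (\1_(~` D) (vadd z))%:E : \bar R).
  exact: (measurableT_comp mEi (@measurable_vadd R d)).
have Dv0 (z : 'rV[R]_d * 'rV[R]_d) : (0 <= (\1_(~` D) (vadd z))%:E :> \bar R)%E.
  by rewrite lee_fin.
transitivity (\int[(eta \x nu) \x mu]_z
    ((\1_(~` D) (vadd z.1))%:E * (enorm z.2 ^+ 2)%:E))%E.
  by apply: eq_integral => z _; rewrite -EFinM.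
apply: (etrans (ge0_integral_prodM (eta \x nu)%E mu mDv Dv0 mE2 E20)).
congr (_ * _)%E.
transitivity (\int[rho]_x (\1_(~` D) x)%:E)%E.
  by rewrite /rho /convolution ge0_integral_distribution.
by rewrite integral_indic// setIT.
Qed.

End coupling.

End W2_bound.

(** * Truncated Gaussian convolutions *)

Section truncated_convolution.
Context {R : realType} {d : nat}.

Lemma second_moment_ge0 (mu : probability 'rV[R]_d R) : (0 <= second_moment mu)%E.
Proof. by apply: integral_ge0 => x _; rewrite lee_fin sqr_ge0. Qed.

Lemma P2_second_momentE (mu : probability 'rV[R]_d R) : P2 mu ->
  second_moment mu = (fine (second_moment mu))%:E.
Proof. by move=> P2mu; rewrite fineK// ge0_fin_numE// second_moment_ge0. Qed.

Lemma W2_truncation_le (eta nu : probability 'rV[R]_d R) (eps : R)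
    (D : set 'rV[R]_d) (mD : measurable D) :
    let rho := convolution eta nu in let p := fine (rho D) in
    0 < eps -> (second_moment eta <= (eps ^+ 2 / 4)%:E)%E -> P2 rho ->
    (0 < rho D)%E ->
    (1 - p) * fine (second_moment rho) <= p * (eps ^+ 2 / 16) ->
    (\int[rho]_(x in ~` D) (enorm x ^+ 2)%:E <= (eps ^+ 2 / 16)%:E)%E ->
  (W2 (truncation rho mD) nu <= eps%:E)%E.
Proof.
move=> rho p eps0 eta2 P2rho D0 hp tail.
have p0 : 0 < p := probability_fine_gt0 mD D0.
have CE : rho (~` D) = (1 - p)%:E by rewrite (probability_setC rho mD) (probability_fineE rho mD).
have p1 : 0 <= 1 - p by rewrite -lee_fin -CE.
have -> : eps%:E = sqrte (eps ^+ 2)%:E by rewrite /= sqrtr_sqr gtr0_norm.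
rewrite /W2 lee_sqrt ?lee_fin ?sqr_ge0//.
apply: (@le_trans _ _
  (\int[resample_coupling eta nu mD]_z (enorm (z.1 - z.2) ^+ 2)%:E)%E).
  apply: ereal_inf_lbound; exists (resample_coupling eta nu mD) => //.
  exact: resample_couplingP.
apply: le_trans (resample_coupling_cost_le eta nu mD) _.
have tr2 : (second_moment (truncation rho mD) <=
    (p^-1 * fine (second_moment rho))%:E)%E.
  rewrite EFinM -P2_second_momentE//; apply: ge0_integral_truncation_le => //.
    by apply/measurable_EFinP; exact: measurable_enorm_sqr.
  by move=> x; rewrite lee_fin sqr_ge0.
apply: (@le_trans _ _ (2%:E * (eps ^+ 2 / 4)%:E +
    4%:E * ((eps ^+ 2 / 16)%:E + (1 - p)%:E * (p^-1 * fine (second_moment rho))%:E))%E).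
  apply: leeD; first exact: lee_wpmul2l.
  apply: lee_wpmul2l => //; apply: leeD => //.
  by rewrite [X in (X * _)%E]CE; apply: lee_wpmul2l.
rewrite [leLHS](_ : _ = (2 * (eps ^+ 2 / 4) + 4 * (eps ^+ 2 / 16 +
  (1 - p) * (p^-1 * fine (second_moment rho))))%:E)// lee_fin.
have : (1 - p) * (p^-1 * fine (second_moment rho)) <= eps ^+ 2 / 16.
  by rewrite mulrCA ler_pdivrMl.
by lra.
Qed.

(** Division by zero yields zero, so that for [m = 0] the hypothesis reads
    [1 <= p] and the conclusion still holds. *)
Lemma truncation_mass_bound (p m e : R) : 0 <= m -> 0 <= e ->
  (1 + e / (16 * m))^-1 <= p -> 0 < p /\ (1 - p) * m <= p * (e / 16).
Proof.
move=> m0 e0 hp.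
have K0 : 0 < 1 + e / (16 * m).
  by rewrite ltr_wpDr// divr_ge0// mulr_ge0.
have p0 : 0 < p by apply: lt_le_trans hp; rewrite invr_gt0.
split=> //; move: m0; rewrite le_eqVlt => /orP[/eqP <-|m0].
  by rewrite mulr0 mulr_ge0 ?(ltW p0)// divr_ge0.
have : 1 <= p * (1 + e / (16 * m)) by rewrite -ler_pdivrMr// mul1r.
move=> /(ler_wpM2r (ltW m0)); rewrite mul1r.
have -> : p * (1 + e / (16 * m)) * m = p * m + p * (e / 16).
  by field; rewrite gt_eqF.
by lra.
Qed.

(** Large balls carry almost all of the mass and of the second moment. *)
Lemma exists_radius (rho : probability 'rV[R]_d R) (k e : R) :
    P2 rho -> k < 1 -> 0 < e -> exists2 r, 0 < r &
  (k%:E <= rho (eball d r))%E /\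
  (\int[rho]_(x in ~` eball d r) (enorm x ^+ 2)%:E <= e%:E)%E.
Proof.
move=> P2rho k1 e0.
pose F (n : nat) : set 'rV[R]_d := eball d n.+1%:R.
have mF n : measurable (F n) by exact: measurable_eball.
have ndF : {homo F : n m / (n <= m)%N >-> (n <= m)%O}.
  move=> n m nm; rewrite subsetEset => x; rewrite /F /eball /= => /le_trans; apply.
  by rewrite ler_nat.
have UF : \bigcup_n F n = setT.
  apply/seteqP; split => // x _; exists (Num.truncn (enorm x)) => //.
  by apply: ltW; exact: Num.Theory.truncnS_gt.
have m2 : measurable_fun setT (fun x : 'rV[R]_d => (enorm x ^+ 2)%:E).
  by apply/measurable_EFinP; exact: measurable_enorm_sqr.
have c1 : rho (F n) @[n --> \oo] --> rho setT.
  rewrite -UF; apply: nondecreasing_cvg_mu => //.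
  exact: bigcup_measurable.
have c2 : (\int[rho]_(x in F n) (enorm x ^+ 2)%:E)%E @[n --> \oo] --> second_moment rho.
  rewrite /second_moment -[in X in _ --> X]UF.
  apply: ge0_nondecreasing_set_cvg_integral => //.
  - by move=> n; exact: measurable_funTS.
  - by move=> n x _; rewrite lee_fin sqr_ge0.
have n1 : \forall n \near \oo, (k%:E < rho (F n))%E.
  apply: (c1 [set x | (k%:E < x)%E]); apply: open_nbhs_nbhs; split.
    exact: open_ereal_gt_ereal.
  by rewrite /= probability_setT lte_fin.
have n2 : \forall n \near \oo,
    ((fine (second_moment rho) - e)%:E < \int[rho]_(x in F n) (enorm x ^+ 2)%:E)%E.
  apply: (c2 [set x | ((fine (second_moment rho) - e)%:E < x)%E]); apply: open_nbhs_nbhs.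
  split; first exact: open_ereal_gt_ereal.
  by rewrite /= (P2_second_momentE P2rho) lte_fin /= ltrBlDr ltrDl.
have [n [h1 h2]] : exists n, (k%:E < rho (F n))%E /\
    ((fine (second_moment rho) - e)%:E < \int[rho]_(x in F n) (enorm x ^+ 2)%:E)%E.
  have [N _ NP] := filterI n1 n2.
  by exists N; apply: NP => /=.
exists n.+1%:R => //; split; first exact: ltW.
have mFC := measurableC (mF n).
have E : second_moment rho = (\int[rho]_(x in F n) (enorm x ^+ 2)%:E +
    \int[rho]_(x in ~` F n) (enorm x ^+ 2)%:E)%E.
  rewrite -ge0_integral_setU//.
  - by rewrite setUCr.
  - by rewrite setUCr.
  - by move=> x _; rewrite lee_fin sqr_ge0.
  - by rewrite disj_set2E setICr.
have I1 : (0 <= \int[rho]_(x in F n) (enorm x ^+ 2)%:E)%E.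
  by apply: integral_ge0 => x _; rewrite lee_fin sqr_ge0.
have I2 : (0 <= \int[rho]_(x in ~` F n) (enorm x ^+ 2)%:E)%E.
  by apply: integral_ge0 => x _; rewrite lee_fin sqr_ge0.
rewrite -/(F n); move: E h2 I1 I2; rewrite (P2_second_momentE P2rho) /=.
set a := (\int[rho]_(x in F n) _)%E; set b := (\int[rho]_(x in ~` F n) _)%E.
case: a => [a||]; case: b => [b||] //=.
by rewrite -EFinD !lte_fin !lee_fin => -[->]; lra.
Qed.

Lemma gaussian_law_has_density (s : R) (eta : probability 'rV[R]_d R) : 0 < s ->
  gaussian_law 0 s%:M eta -> has_density eta (@gauss R s d).
Proof.
move=> s0; rewrite /gaussian_law.
by have -> : gaussian_pdf 0 s%:M = @gauss R s d
  by apply/funext => x; rewrite gaussian_pdf_scalar.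
Qed.

Lemma gauss_le (s : R) (x : 'rV[R]_d) : 0 < s ->
  gauss s x <= normal_peak (Num.sqrt s) ^+ d.
Proof.
move=> s0; rewrite /gauss ler_piMr ?exprn_ge0 ?normal_peak_ge0//.
rewrite -[leRHS]expR0 ler_expR oppr_le0 divr_ge0 ?sqr_ge0//.
by rewrite mulrn_wge0// ltW.
Qed.

(** The hypothesis on the mass of the ball is multiplied out, so that it does not
    divide by the second moment of [rho]. *)
Lemma truncated_gaussian_convolution (d_gt0 : (0 < d)%N)
    (nu eta : probability 'rV[R]_d R) q (eps r : R) :
    P2 nu -> 0 < eps -> gaussian_law 0 (eps ^+ 2 / (4 * d%:R))%:M eta ->
    let rho := convolution eta nu in P2 rho /\
    (0 < r -> 0 < fine (rho (eball d r)) ->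
     (1 - fine (rho (eball d r))) * fine (second_moment rho) <=
       fine (rho (eball d r)) * (eps ^+ 2 / 16) ->
     (\int[rho]_(x in ~` eball d r) (enorm x ^+ 2)%:E <= (eps ^+ 2 / 16)%:E)%E ->
     Mq q (truncation rho (measurable_eball d r)) /\
     (W2 (truncation rho (measurable_eball d r)) nu <= eps%:E)%E).
Proof.
move=> P2nu eps0 Heta rho; set s := eps ^+ 2 / _ in Heta.
have s0 : 0 < s by rewrite divr_gt0 ?exprn_gt0// mulr_gt0// ltr0n.
have eta2 : (second_moment eta <= (eps ^+ 2 / 4)%:E)%E.
  apply: le_trans (gaussian_second_moment_le s0 Heta) _.
  rewrite lee_fin le_eqVlt; apply/orP; left; apply/eqP; rewrite /s; field.
  by rewrite pnatr_eq0 -lt0n.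
have P2rho : P2 rho.
  apply: le_lt_trans (second_moment_convolution_le eta nu) _.
  rewrite lte_add_pinfty// lte_mul_pinfty// .
  by apply: le_lt_trans eta2 _; rewrite ltry.
split=> // r0 p0 hp tail.
have D0 : (0 < rho (eball d r))%E.
  by rewrite (probability_fineE rho (measurable_eball d r)) lte_fin.
split; last exact: W2_truncation_le.
apply: Mq_truncation (s0) r0 P2rho _ D0; rewrite /rho.
apply: (has_density_convolution nu (fun x => gauss_le x s0)).
exact: gaussian_law_has_density.
Qed.

End truncated_convolution.

Theorem proposition4p3 (R : realType) (d : nat) (d_gt0 : (0 < d)%N) :
  (forall (nu : probability 'rV[R]_d R) (q : nat) (eps : R)
      (eta : probability 'rV[R]_d R),
    P2 nu -> 0 < eps ->
    gaussian_law 0 (eps ^+ 2 / (4 * d%:R))%:M eta ->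
    let rho := convolution eta nu in
    P2 rho /\
    (forall r : R, 0 < r ->
      (((1 + eps ^+ 2 / (16 * fine (second_moment rho)))^-1)%:E
        <= rho (eball d r))%E ->
      (\int[rho]_(x in ~` eball d r) (enorm x ^+ 2)%:E
        <= (eps ^+ 2 / 16)%:E)%E ->
      Mq q (truncation rho (measurable_eball d r)) /\
      (W2 (truncation rho (measurable_eball d r)) nu <= eps%:E)%E)) /\
  (forall (q : nat) (nu : probability 'rV[R]_d R) (delta : R),
    P2 nu -> 0 < delta ->
    exists mu : probability 'rV[R]_d R, Mq q mu /\ (W2 mu nu < delta%:E)%E).
Proof.
split=> [nu q eps eta P2nu eps0 Heta rho|q nu delta P2nu delta0].
  split.
    by have [] := truncated_gaussian_convolution d_gt0 q 0 P2nu eps0 Heta.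
  move=> r r0 hp tail.
  have [_ H] := truncated_gaussian_convolution d_gt0 q r P2nu eps0 Heta.
  have [p0 hp'] : 0 < fine (rho (eball d r)) /\
      (1 - fine (rho (eball d r))) * fine (second_moment rho) <=
       fine (rho (eball d r)) * (eps ^+ 2 / 16).
    apply: truncation_mass_bound; [exact/fine_ge0/second_moment_ge0|exact: sqr_ge0|].
    by rewrite -lee_fin -(probability_fineE rho (measurable_eball d r)).
  exact: H.
(* half of [delta] makes the inequality strict *)
pose eps := delta / 2; have eps0 : 0 < eps by rewrite divr_gt0.
have s0 : 0 < eps ^+ 2 / (4 * d%:R).
  by rewrite divr_gt0 ?exprn_gt0// mulr_gt0// ltr0n.
have [eta Heta] := gaussian_law_exists s0 d.
pose rho := convolution eta nu.
have [P2rho _] := truncated_gaussian_convolution d_gt0 q 0 P2nu eps0 Heta.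
pose m := fine (second_moment rho).
have m0 : 0 <= m by exact/fine_ge0/second_moment_ge0.
(* With [m + 1] instead of [m] the bound [k] is below 1 even if [m = 0]. *)
pose k := (1 + eps ^+ 2 / (16 * (m + 1)))^-1.
have q0 : 0 < eps ^+ 2 / (16 * (m + 1)).
  by rewrite divr_gt0 ?exprn_gt0// mulr_gt0// ltr_wpDl.
have k1 : k < 1 by rewrite invf_lt1 ?ltrDl// ltr_wpDr// ltW.
have e0 : 0 < eps ^+ 2 / 16 by rewrite divr_gt0 ?exprn_gt0.
have [r r0 [hk tail]] := exists_radius P2rho k1 e0.
have [_ H] := truncated_gaussian_convolution d_gt0 q r P2nu eps0 Heta.
have [|p0 hp] := @truncation_mass_bound R (fine (rho (eball d r))) (m + 1)
    (eps ^+ 2) (addr_ge0 m0 ler01) (sqr_ge0 _).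
  by rewrite -lee_fin -(probability_fineE rho (measurable_eball d r)).
have p1 : 0 <= 1 - fine (rho (eball d r)).
  rewrite subr_ge0 -lee_fin -(probability_fineE rho (measurable_eball d r)).
  by apply: probability_le1; exact: measurable_eball.
have [|MqH W2H] := H r0 p0 _ tail.
  by apply: le_trans hp; rewrite ler_wpM2l// lerDl.
exists (truncation rho (measurable_eball d r)); split=> //.
apply: le_lt_trans W2H _; rewrite lte_fin /eps ltr_pdivrMr//.
by rewrite ltr_pMr// ltr1n.
Qed.
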